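(* There exist a real Banach space $Z$ and an exposed point of the unit ball of the symmetric projective tensor product $\widetilde{\otimes}_{\pi_s}^{2,s} Z$ which is not of the form $\pm\, w \otimes w$ for any $w \in Z$.
   Context: All Banach spaces are real. For a Banach space $Z$ and $N \in \mathbb{N}$, $\bigotimes^{N,s} Z$ is the linear span of the elements $z^{\otimes N} = z \otimes \cdots \otimes z$ ($z \in Z$) in the $N$-fold algebraic tensor product of $Z$; the symmetric projective norm on it is $\|u\|_{\pi_s} = \inf\{\sum_{j=1}^n |\lambda_j|\,\|x_j\|^N : u = \sum_{j=1}^n \lambda_j x_j^{\otimes N},\ n \in \mathbb{N}\}$, and $\widetilde{\otimes}_{\pi_s}^{N,s} Z$ is the completion. A point $x$ of a convex subset $A$ of a Banach space $E$ is an exposed point of $A$ if there is $f \in E^*$ with $f(x) > f(y)$ for every $y \in A \setminus \{x\}$. *)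

(* Defs.v *)
From HB Require Import structures.
From mathcomp Require Import all_boot all_order all_algebra.
From mathcomp Require Import all_classical all_reals all_analysis.
Set Implicit Arguments.
Unset Strict Implicit.
Unset Printing Implicit Defensive.
Import Order.TTheory GRing.Theory Num.Theory.
Import numFieldNormedType.Exports.
Local Open Scope classical_set_scope.
Local Open Scope ring_scope.

Definition multilinear (R : realType) (N : nat) (Z W : lmodType R)
    (m : ('I_N -> Z) -> W) : Prop :=
  forall (z : 'I_N -> Z) (i : 'I_N), linear (fun x : Z => m (dfwith z i x)).

Record multilinear_form (R : realType) (N : nat) (Z : lmodType R) :=
  MultilinearForm {
    mform :> ('I_N -> Z) -> R^o ;
    mformP : multilinear mform }.

(* The N-fold algebraic tensor product of Z is realized inside the linear
   functionals on the N-linear forms on Z: the elementary tensor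
   z_0 (x) ... (x) z_(N-1) is evaluation at (z_0, ..., z_(N-1)). Lemma
   [tensor_universal] below shows that the span of these evaluations has the
   universal property of the tensor product. *)
Definition tensor_space (R : realType) (N : nat) (Z : lmodType R) : Type :=
  multilinear_form N Z -> R^o.
HB.instance Definition _ (R : realType) (N : nat) (Z : lmodType R) :=
  GRing.Lmodule.copy (tensor_space N Z) (multilinear_form N Z -> R^o).

Definition tensor (R : realType) (N : nat) (Z : lmodType R)
    (z : 'I_N -> Z) : tensor_space N Z :=
  fun B => B z.

Lemma tensor_multilinear (R : realType) (N : nat) (Z : lmodType R) :
  multilinear (@tensor R N Z).
Proof.
move=> z i a x y; apply/funext => B.
exact: (mformP B).
Qed.

Lemma separating_scalar (R : realType) (W : lmodType R) (w : W) :
  w != 0 -> exists f : {linear W -> R^o}, f w != 0.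
Proof.
move=> w0.
pose P (A : set W) :=
  (forall (a : R) u v, A u -> A v -> A (a *: u + v)) /\ ~ A w.
have [|A [[linA nAw] maxA]] := @Zorn_bigcup W P.
  move=> F FP totF; split; last by move=> [X /FP[_ nXw] /nXw].
  move=> a u v [X FX Xu] [Y FY Yv].
  have [XY|YX] := totF _ _ FX FY.
    by exists Y => //; apply: (FP _ FY).1 => //; exact: XY.
  by exists X => //; apply: (FP _ FX).1 => //; exact: YX.
have A0 : A 0.
  apply: contrapT => nA0; apply: (maxA [set 0]).
    split; last by move=> /(_ 0 erefl).
    move=> u Au; exfalso; apply: nA0.
    by rewrite -(addNr u) -scaleN1r; exact: linA.
  split=> [a u v /= -> ->|/= /eqP]; first by rewrite scaler0 addr0.
  by rewrite (negbTE w0).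
have decA v : exists a : R, A (v - a *: w).
  have [Av|nAv] := pselect (A v); first by exists 0; rewrite scale0r subr0.
  pose B := [set u | exists c : R, exists2 h, A h & u = h + c *: v].
  have [[c [h Ah wE]]|nBw] := pselect (B w).
    have c0 : c != 0.
      by apply/eqP => c0; apply: nAw; rewrite wE c0 scale0r addr0.
    exists c^-1; rewrite wE scalerDr scalerA mulVf // scale1r opprD addrCA.
    by rewrite subrr -scaleNr; exact: linA.
  exfalso; apply: (maxA B).
    split; last first.
      by move=> /(_ v) BA; apply/nAv/BA; exists 1, 0; rewrite ?add0r ?scale1r.
    by move=> u Au; exists 0, u; rewrite ?scale0r ?addr0.
  split=> // a u1 u2 [c1 [h1 Ah1 ->]] [c2 [h2 Ah2 ->]].
  exists (a * c1 + c2), (a *: h1 + h2); first exact: linA.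
  by rewrite scalerDl -scalerA scalerDr addrACA.
have uniqA v a b : A (v - a *: w) -> A (v - b *: w) -> a = b.
  move=> Aa Ab; apply/eqP; rewrite -subr_eq0; apply/eqP; apply: contrapT.
  move=> /eqP ab0; apply: nAw.
  have Aab : A ((a - b) *: w).
    have -> : (a - b) *: w = -1 *: (v - a *: w) + (v - b *: w).
      by rewrite scaleN1r opprB scalerBl addrA subrK.
    exact: linA.
  have := linA (a - b)^-1 _ _ Aab A0.
  by rewrite addr0 scalerA mulVf // scale1r.
pose g v : R^o := projT1 (cid (decA v)).
have gP v : A (v - g v *: w) by rewrite /g; case: cid.
have lin_g : linear g.
  move=> a u v; apply: (uniqA (a *: u + v)); first exact: gP.
  have -> : a *: u + v - (a *: g u + g v : R^o) *: w
          = a *: (u - g u *: w) + (v - g v *: w).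
    by rewrite scalerDl -scalerA scalerBr opprD addrACA.
  by apply: linA.
pose gL : GRing.isLinear R W R^o _ g := GRing.isLinear.Build R W R^o _ g lin_g.
pose G : {linear W -> R^o} := HB.pack g gL.
exists G; rewrite /= (_ : g w = 1) ?oner_eq0//.
by apply: (uniqA w); [exact: gP | rewrite scale1r subrr].
Qed.

(* A multilinear map factors (uniquely) through the span of the elementary
   tensors: every linear relation among these is satisfied by its values. *)
Lemma tensor_universal (R : realType) (N : nat) (Z W : lmodType R)
    (m : ('I_N -> Z) -> W) (n : nat) (l : 'I_n -> R) (z : 'I_n -> 'I_N -> Z) :
  multilinear m ->
  \sum_(j < n) l j *: tensor (z j) = 0 -> \sum_(j < n) l j *: m (z j) = 0.
Proof.
move=> mlin tens0; apply/eqP/negPn/negP => /separating_scalar[f].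
have mfP : multilinear (fun z => f (m z)).
  by move=> y i a u v; rewrite /= mlin linearP.
have := congr1 (fun u : tensor_space N Z => u (MultilinearForm mfP)) tens0.
rewrite linear_sum/= => tB; apply/negP/negPn/eqP.
rewrite -[RHS]tB fct_sumE; apply: eq_bigr => j _.
by rewrite linearZ.
Qed.

Definition is_sym_tensor (R : realType) (N : nat) (Z : lmodType R) :
    {pred tensor_space N Z} :=
  fun u => `[< exists (n : nat) (l : 'I_n -> R) (x : 'I_n -> Z),
                 u = \sum_(j < n) l j *: tensor (fun=> x j) >].

Lemma is_sym_tensor_submod (R : realType) (N : nat) (Z : lmodType R) :
  GRing.submod_closed (@is_sym_tensor R N Z).
Proof.
split=> [|a u v /asboolP[n [l [x ->]]] /asboolP[m [k [y ->]]]].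
  by apply/asboolP; exists 0, (fun=> 0), (fun=> 0); rewrite big_ord0.
apply/asboolP; exists (n + m)%N.
exists (fun j : 'I_(n + m) =>
  match fintype.split j with inl i => a * l i | inr i => k i end).
exists (fun j : 'I_(n + m) => match fintype.split j with inl i => x i | inr i => y i end).
rewrite big_split_ord /= scaler_sumr; congr (_ + _); apply: eq_bigr => j _.
  have := unsplitK (inl j : 'I_n + 'I_m); rewrite /= => ->.
  by rewrite scalerA.
by have := unsplitK (inr j : 'I_n + 'I_m); rewrite /= => ->.
Qed.

HB.instance Definition _ (R : realType) (N : nat) (Z : lmodType R) :=
  GRing.isSubmodClosed.Build R (tensor_space N Z) (@is_sym_tensor R N Z)
    (@is_sym_tensor_submod R N Z).

Record sym_tensor (R : realType) (N : nat) (Z : lmodType R) := SymTensor {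
  sym_tensor_val :> tensor_space N Z ;
  sym_tensorP : sym_tensor_val \in @is_sym_tensor R N Z }.

HB.instance Definition _ (R : realType) (N : nat) (Z : lmodType R) :=
  [isSub for @sym_tensor_val R N Z].
HB.instance Definition _ (R : realType) (N : nat) (Z : lmodType R) :=
  [Choice of @sym_tensor R N Z by <:].
HB.instance Definition _ (R : realType) (N : nat) (Z : lmodType R) :=
  [SubChoice_isSubLmodule of @sym_tensor R N Z by <:].

Lemma tensor_pow_subproof (R : realType) (N : nat) (Z : lmodType R) (z : Z) :
  tensor (fun=> z) \in @is_sym_tensor R N Z.
Proof.
apply/asboolP; exists 1%N, (fun=> 1), (fun=> z).
by rewrite big_ord1 scale1r.
Qed.

Definition tensor_pow (R : realType) (N : nat) (Z : lmodType R) (z : Z) :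
    sym_tensor N Z :=
  SymTensor (tensor_pow_subproof N z).

Definition sym_proj_norm (R : realType) (N : nat) (Z : normedModType R)
    (u : sym_tensor N Z) : R :=
  inf [set r : R | exists (n : nat) (l : 'I_n -> R) (x : 'I_n -> Z),
         u = \sum_(j < n) l j *: tensor_pow N (x j) /\
         r = \sum_(j < n) `|l j| * `|x j| ^+ N].

(* A completion of the symmetric tensors for the symmetric projective norm:
   a Banach space with a norm-preserving linear map of dense range. It is
   determined up to isometric isomorphism compatible with the map. *)
Record sym_proj_tensor_product (R : realType) (N : nat)
    (Z : normedModType R) := SymProjTensorProduct {
  sym_proj_space :> completeNormedModType R ;
  sym_proj_emb : {linear sym_tensor N Z -> sym_proj_space} ;
  sym_proj_emb_norm : forall u, `|sym_proj_emb u| = sym_proj_norm u ;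
  sym_proj_emb_dense : dense (range sym_proj_emb) }.

Definition exposed_point (R : realType) (E : normedModType R) (A : set E)
    (x : E) : Prop :=
  A x /\ exists f : {scalar E}, continuous f /\
           forall y : E, A y -> y <> x -> f y < f x.

Definition closed_unit_ball (R : realType) (E : normedModType R) : set E :=
  [set x | `|x| <= 1].

(* Main.v *)
(* If Z has finite dimension, every extreme point of the unit ball of the
   symmetric projective square is some +- w (x) w, so Z has to be infinite
   dimensional. We take a codimension-two subspace of c_0: its elements are
   families (u_(b,i), y_n), b a sign, i < 3, with
   sum_i u_(b,i) = s := sum_n 2^-(n+1) y_n for both b. The functional s has norm
   one and does not attain it. Put tau_(b,i) = (s - u_(b,i)) / 2; then
   sum_i tau_(b,i) = s and sum_i |tau_(b,i)| <= |z|, so that the form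
   P(z) = 3/2 (sum_i tau_(+,i)^2 - sum_i tau_(-,i)^2) satisfies |P(z)| <= |z|^2.
   In the bidual, |P| = 1 on the unit ball only at six points (up to sign)
   a_(b,j) = A_(b,j) + psi, where P(a_(b,j)) = b, the A_(b,j) lie in Z,
   s(A_(b,j)) = 0, sum_j A_(b,j) = 0, and psi does not lie in Z. Let
   v := 1/6 sum_(b,j) b A_(b,j)^2 = 1/6 sum_(b,j) b a_(b,j)^2. The second
   expression persists when psi is replaced by elements of Z close to it, hence
   |v| <= 1, whereas P(v) = 1.

   Conversely, a tensor g of norm one with P(g) = 1 is a limit of
   combinations of squares concentrated near the points a_(b,j). Near these,
   y_n is close to s for each fixed n; since y_n -> 0 pointwise on Z, the form
   s l vanishes at g for every bounded functional l. Consequently g only sees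
   the coordinates along the A_(b,j), and there the products
   tau_(b,i) tau_(c,j) have prescribed multiples of P(g) as values. So g is
   unique. It is not +- w (x) w since the form (tau_(b,0) - tau_(b,1))^2 has the
   value b/3 at v. *)
Require Import Defs.
From HB Require Import structures.
From mathcomp Require Import all_boot all_order all_algebra.
From mathcomp Require Import all_classical all_reals all_analysis.
From mathcomp Require Import ring lra.
Import Order.TTheory GRing.Theory Num.Theory.
Import numFieldNormedType.Exports.
Local Open Scope classical_set_scope.
Local Open Scope ring_scope.

Set Implicit Arguments.
Unset Strict Implicit.
Unset Printing Implicit Defensive.


(** * Closed spaces of bounded functions *)

(** Both [exZ] and the completion of the symmetric tensors are instances, so supremum norm and
    completeness are treated once. *)
Record fun_space (R : realType) (X : Type) := FunSpace {
  fs_pred :> {pred X -> R^o} ;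
  fs_submod : GRing.submod_closed fs_pred ;
  fs_bounded : forall f, f \in fs_pred -> exists M, forall x, `|f x| <= M ;
  fs_closed : forall f,
    (forall e, 0 < e ->
       exists2 g, g \in fs_pred & forall x, `|f x - g x| <= e) ->
    f \in fs_pred }.

HB.instance Definition _ (R : realType) (X : Type) (S : fun_space R X) :=
  GRing.isSubmodClosed.Build R (X -> R^o) (fs_pred S) (fs_submod S).

Record fun_elt (R : realType) (X : Type) (S : fun_space R X) := FunElt {
  fun_elt_val :> X -> R^o ;
  fun_eltP : fun_elt_val \in fs_pred S }.

HB.instance Definition _ (R : realType) (X : Type) (S : fun_space R X) :=
  [isSub for @fun_elt_val R X S].
HB.instance Definition _ (R : realType) (X : Type) (S : fun_space R X) :=
  [Choice of fun_elt S by <:].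
HB.instance Definition _ (R : realType) (X : Type) (S : fun_space R X) :=
  [SubChoice_isSubLmodule of fun_elt S by <:].

Section fun_norm.
Variables (R : realType) (X : Type) (S : fun_space R X).
Implicit Types f g : fun_elt S.

(** The value 0 is adjoined to keep the set nonempty when [X] is empty. *)
Definition fun_norm f : R :=
  sup [set r : R | r = 0 \/ exists x, r = `|f x|].

Lemma fun_norm_has_sup f : has_sup [set r : R | r = 0 \/ exists x, r = `|f x|].
Proof.
split; first by exists 0; left.
have [M fM] := fs_bounded (fun_eltP f).
exists (Num.max 0 M) => r [->|[x ->]]; first by rewrite le_max lexx.
by rewrite le_max fM orbT.
Qed.

Lemma le_fun_norm f x : `|f x| <= fun_norm f.
Proof. by apply: sup_upper_bound; [exact: fun_norm_has_sup | right; exists x]. Qed.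

Lemma fun_norm_ge0 f : 0 <= fun_norm f.
Proof. by apply: sup_upper_bound; [exact: fun_norm_has_sup | left]. Qed.

Lemma fun_norm_le f M : 0 <= M -> (forall x, `|f x| <= M) -> fun_norm f <= M.
Proof.
move=> M0 fM; apply: ge_sup; first exact: (fun_norm_has_sup f).1.
by move=> r [->|[x ->]].
Qed.

Lemma fun_eltD f g x : (f + g) x = f x + g x. Proof. by []. Qed.
Lemma fun_eltN f x : (- f) x = - f x. Proof. by []. Qed.
Lemma fun_eltZ a f x : (a *: f) x = a * f x. Proof. by []. Qed.

Lemma fun_norm_normD f g : fun_norm (f + g) <= fun_norm f + fun_norm g.
Proof.
apply: fun_norm_le; first by rewrite addr_ge0// fun_norm_ge0.
by move=> x; rewrite (le_trans (ler_normD _ _))// lerD// le_fun_norm.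
Qed.

Lemma fun_norm_leZ a f : fun_norm (a *: f) <= `|a| * fun_norm f.
Proof.
apply: fun_norm_le; first by rewrite mulr_ge0// fun_norm_ge0.
by move=> x; rewrite fun_eltZ normrM ler_wpM2l// le_fun_norm.
Qed.

Lemma fun_norm_normZ a f : fun_norm (a *: f) = `|a| * fun_norm f.
Proof.
apply/eqP; rewrite eq_le fun_norm_leZ /=.
have [->|a0] := eqVneq a 0; first by rewrite normr0 mul0r fun_norm_ge0.
(* The converse inequality is the one just proved, applied to [a^-1] and [a *: f]. *)
rewrite -ler_pdivlMl ?normr_gt0// -normfV.
by rewrite -[X in fun_norm X <= _](scalerK a0) fun_norm_leZ.
Qed.

Lemma fun_norm_eq0 f : fun_norm f = 0 -> f = 0.
Proof.
move=> f0; apply/val_inj/funext => x /=; apply/eqP.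
by rewrite -normr_le0 -f0 le_fun_norm.
Qed.

End fun_norm.

HB.instance Definition _ (R : realType) (X : Type) (S : fun_space R X) :=
  Lmodule_isNormed.Build R (fun_elt S)
    (@fun_norm_normD R X S) (@fun_norm_normZ R X S) (@fun_norm_eq0 R X S).

Section fun_complete.
Variables (R : realType) (X : Type) (S : fun_space R X).

Lemma fun_normE (f : fun_elt S) : `|f| = fun_norm f. Proof. by []. Qed.

(** Pointwise limits exist since [R] is complete. The Cauchy estimate is uniform in the point and
    survives the limit, so [fs_closed] puts the limit function into the space. *)
Lemma fun_complete (F : set_system (fun_elt S)) :
  ProperFilter F -> cauchy F -> cvg F.
Proof.
move=> FF /cauchyP Fc.
have Fe e : 0 < e -> exists f, \forall g \near F, `|f - g| < e.
  move=> e0; have [f fF] := Fc _ e0; exists f.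
  by apply: filterS fF => g; rewrite -ball_normE.
have evc x : cvg ((fun f : fun_elt S => f x : R^o) @ F).
  apply: cauchy_cvg; apply/cauchyP => e e0.
  have [f fF] := Fe _ e0; exists (f x); rewrite /= nbhs_simpl/=.
  apply: filterS fF => g fg; rewrite -ball_normE /ball_ /=.
  apply: le_lt_trans fg.
  by rewrite fun_normE -fun_eltN -fun_eltD; exact: le_fun_norm.
pose h x : R^o := lim ((fun f : fun_elt S => f x : R^o) @ F).
have hle e : 0 < e -> exists f, (\forall g \near F, `|f - g| < e) /\
    forall x, `|h x - f x| <= e.
  move=> e0; have [f fF] := Fe _ e0; exists f; split => // x.
  rewrite distrC.
  apply: (@cvgr_to_le _ F _ _ (fun g : fun_elt S => `|f x - g x|)).
    by apply: cvg_norm; apply: cvgB; [exact: cvg_cst | exact: evc].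
  apply: filterS fF => g /ltW; apply: le_trans.
  by rewrite fun_normE -fun_eltN -fun_eltD; exact: le_fun_norm.
have hS : h \in fs_pred S.
  apply: fs_closed => e e0; have [f [_ fh]] := hle _ e0.
  by exists (fun_elt_val f) => //; exact: fun_eltP.
apply/cvg_ex; exists (FunElt hS); apply/cvgrPdist_le => e e0.
have e20 : 0 < e / 2 by rewrite divr_gt0.
have [f [fF fh]] := hle _ e20.
apply: filterS fF => g /ltW fg.
rewrite (splitr e) -(subrKA f) (le_trans (ler_normD _ _))// lerD//.
by rewrite fun_normE fun_norm_le// ltW.
Qed.

End fun_complete.

HB.instance Definition _ (R : realType) (X : Type) (S : fun_space R X) :=
  Uniform_isComplete.Build (fun_elt S) (@fun_complete R X S).

(** * The completion of a seminormed space *)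

Section hahn_banach.
Variables (R : realType) (V : lmodType R) (p : V -> R).
Hypothesis pD : forall u v, p (u + v) <= p u + p v.
Hypothesis pZ : forall a u, p (a *: u) = `|a| * p u.

Lemma seminorm0 : p 0 = 0.
Proof. by rewrite -(scale0r 0) pZ normr0 mul0r. Qed.

Lemma seminormN u : p (- u) = p u.
Proof. by rewrite -scaleN1r pZ normrN1 mul1r. Qed.

Lemma seminorm_ge0 u : 0 <= p u.
Proof.
have := pD u (- u); rewrite subrr seminorm0 seminormN -mulr2n.
by rewrite pmulrn_lge0.
Qed.

(* Partial functionals are represented by their graphs. *)
Definition dominated_graph (A : set (V * R)) : Prop :=
  (forall (a : R) x y, A x -> A y -> A (a *: x.1 + y.1, a * x.2 + y.2)) /\
  (forall x, A x -> x.2 <= p x.1).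

(** The value r at v has to lie above every x.2 - p (x.1 - v) and below every p (x.1 + v) - x.2.
    Subadditivity puts the former numbers below the latter, so their supremum will do; homogeneity
    reduces the other multiples of v to v and -v. *)
Lemma dominated_graph_extend A v : dominated_graph A -> A (0, 0) ->
  exists B, [/\ dominated_graph B, A `<=` B & exists r, B (v, r)].
Proof.
move=> [linA domA] A0.
have AZ a x : A x -> A (a *: x.1, a * x.2).
  by move=> Ax; have := linA a _ _ Ax A0; rewrite /= !addr0.
pose D := [set r : R | exists2 x, A x & r = x.2 - p (x.1 - v)].
have Dub x : A x -> ubound D (p (x.1 + v) - x.2).
  move=> Ax _ [y Ay ->].
  have := linA 1 _ _ Ax Ay; rewrite scale1r mul1r => /domA /= h.
  have := pD (x.1 + v) (y.1 - v); rewrite addrACA subrr addr0; lra.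
have supD : has_sup D.
  by split; [exists (0 - p (0 - v)), (0, 0) | exists (p (0 + v) - 0); exact: (Dub (0, 0))].
pose r := sup D.
have rge x : A x -> x.2 - p (x.1 - v) <= r.
  by move=> Ax; apply: sup_upper_bound => //; exists x.
have rle x : A x -> r <= p (x.1 + v) - x.2.
  by move=> Ax; apply: ge_sup; [exact: supD.1 | exact: Dub].
exists [set z | exists c x, A x /\ z = (x.1 + c *: v, x.2 + c * r)].
split; [split| |].
- move=> a _ _ [c [x [Ax ->]]] [d [y [Ay ->]]].
  exists (a * c + d), (a *: x.1 + y.1, a * x.2 + y.2); split; first exact: linA.
  congr (_, _) => /=; last by ring.
  by rewrite scalerDr scalerDl scalerA addrACA.
- move=> _ [c [x [Ax ->]]] /=.
  have [->|c0] := eqVneq c 0.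
    by rewrite scale0r mul0r !addr0 domA.
  have [cp|cn] := ltP 0 c.
    have := rle _ (AZ c^-1 _ Ax); rewrite /= => h.
    have -> : x.1 + c *: v = c *: (c^-1 *: x.1 + v).
      by rewrite scalerDr scalerA mulfV// scale1r.
    rewrite pZ gtr0_norm// -lerBrDl -ler_pdivlMl//; apply: le_trans h _.
    by rewrite mulrBr mulrA mulVf// mul1r.
  have {cn}cn : 0 < - c by rewrite oppr_gt0 lt_neqAle c0.
  have := rge _ (AZ (- c)^-1 _ Ax); rewrite /= => h.
  have -> : x.1 + c *: v = (- c) *: ((- c)^-1 *: x.1 - v).
    by rewrite scalerBr scalerA mulfV ?gt_eqF// scale1r scaleNr opprK.
  rewrite pZ gtr0_norm//.
  have := ler_wpM2l (ltW cn) h; rewrite mulrBr mulrA mulfV ?gt_eqF// mul1r.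
  lra.
- by move=> x Ax; exists 0, x; split=> //; rewrite scale0r mul0r !addr0; case: x {Ax}.
- by exists r, 1, (0, 0); split=> //; rewrite scale1r mul1r !add0r.
Qed.

Lemma hahn_banach u0 :
  exists F : {linear V -> R^o}, F u0 = p u0 /\ forall u, `|F u| <= p u.
Proof.
pose L := [set z : V * R | exists c, z = (c *: u0, c * p u0)].
have domL : dominated_graph L.
  split=> [a _ _ [c ->] [d ->]|_ [c ->]] /=.
    by exists (a * c + d); rewrite scalerDl scalerA mulrDl mulrA.
  by rewrite pZ ler_wpM2r ?seminorm_ge0// ler_norm.
pose P A := dominated_graph A /\ (A = set0 \/ L `<=` A).
have [|A [[[linA domA] LA] maxA]] := @Zorn_bigcup _ P.
  move=> F FP totF; split; last first.
    have [[B FB LB]|nL] := pselect (exists2 B, F B & L `<=` B).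
      by right => x Lx; exists B => //; exact: LB.
    left; apply/seteqP; split=> // x [B FB Bx].
    by have [_ [B0|LB]] := FP _ FB; [rewrite B0 in Bx | apply: nL; exists B].
  split=> [a x y [X FX Xx] [Y FY Yy]|x [X FX Xx]]; last exact: (FP _ FX).1.2.
  have [XY|YX] := totF _ _ FX FY.
    by exists Y => //; apply: (FP _ FY).1.1 => //; exact: XY.
  by exists X => //; apply: (FP _ FX).1.1 => //; exact: YX.
have {}LA : L `<=` A.
  case: LA => // A0; exfalso; apply: (maxA L); last by split; [|right].
  by rewrite A0; split=> // /(_ (0, 0)); apply; exists 0; rewrite scale0r mul0r.
have A0 : A (0, 0) by apply: LA; exists 0; rewrite scale0r mul0r.
have totA v : exists r, A (v, r).
  have [B [domB AB [r Br]]] := dominated_graph_extend v (conj linA domA) A0.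
  exists r; apply: contrapT => nAr; apply: (maxA B).
    by split=> // /(_ _ Br).
  by split=> //; right; exact: subset_trans LA AB.
have uniqA v r s : A (v, r) -> A (v, s) -> r = s.
  move=> Ar As; apply/eqP; rewrite eq_le.
  have h x y : A (v, x) -> A (v, y) -> x <= y.
    move=> Ax Ay; have := domA _ (linA (-1) _ _ Ay Ax).
    by rewrite /= scaleN1r addNr seminorm0 mulN1r addrC subr_le0.
  by rewrite !h.
pose F v : R^o := projT1 (cid (totA v)).
have FA v : A (v, F v) by rewrite /F; case: cid.
have linF : linear F.
  by move=> a u v; apply: uniqA (FA _) _; exact: (linA a _ _ (FA u) (FA v)).
pose FL : GRing.isLinear R V R^o _ F := GRing.isLinear.Build R V R^o _ F linF.
pose G : {linear V -> R^o} := HB.pack F FL.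
exists G; split; first by apply: uniqA (FA _) (LA _ _); exists 1; rewrite scale1r mul1r.
move=> u; rewrite ler_norml; apply/andP; split; last exact: domA (FA u).
by rewrite lerNl -(linearN G) -(seminormN u); exact: domA (FA (- u)).
Qed.

End hahn_banach.

(* An element of the completion is represented by its values on the unit ball
   of the dual; by Hahn-Banach the supremum norm there is the seminorm [p]. *)
Section completion.
Variables (R : realType) (V : lmodType R) (p : V -> R).
Hypothesis pD : forall u v, p (u + v) <= p u + p v.
Hypothesis pZ : forall a u, p (a *: u) = `|a| * p u.

Definition dual_ball := {F : {linear V -> R^o} | forall u, `|F u| <= p u}.

(** The uniform closure of the evaluations at elements of [V]. *)
Definition completion_pred : {pred dual_ball -> R^o} := fun f =>
  `[< forall e, 0 < e -> exists u, forall F, `|f F - sval F u| <= e >].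

Lemma completion_submod : GRing.submod_closed completion_pred.
Proof.
split=> [|a f g /asboolP fS /asboolP gS]; apply/asboolP => e e0.
  by exists 0 => F; rewrite linear0 subrr normr0 ltW.
(* The denominator 1 + |a| spares the case a = 0. *)
have e1 : 0 < e / 2 / (1 + `|a|) by rewrite !divr_gt0// ltr_pwDl.
have e2 : 0 < e / 2 by rewrite divr_gt0.
have [u fu] := fS _ e1; have [v gv] := gS _ e2.
exists (a *: u + v) => F; rewrite linearP /=.
have -> : (a *: f + g) F - (a * sval F u + sval F v) =
    a * (f F - sval F u) + (g F - sval F v).
  by rewrite mulrBr opprD addrACA.
rewrite (splitr e) (le_trans (ler_normD _ _))// lerD// normrM.
rewrite (le_trans (ler_wpM2l (normr_ge0 _) (fu F)))//.
rewrite mulrCA ler_piMr ?(ltW e2)// ler_pdivrMr ?mul1r; last by rewrite ltr_pwDl.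
by rewrite lerDr.
Qed.

Lemma completion_bounded f : f \in completion_pred ->
  exists M, forall F, `|f F| <= M.
Proof.
move=> /asboolP /(_ 1 ltr01)[u fu]; exists (1 + p u) => F.
by rewrite -[f F](subrK (sval F u)) (le_trans (ler_normD _ _))// lerD ?(svalP F).
Qed.

Lemma completion_closed f :
  (forall e, 0 < e ->
     exists2 g, g \in completion_pred & forall F, `|f F - g F| <= e) ->
  f \in completion_pred.
Proof.
move=> fg; apply/asboolP => e e0.
have e2 : 0 < e / 2 by rewrite divr_gt0.
have [g /asboolP /(_ _ e2)[u gu] {}fg] := fg _ e2.
exists u => F; rewrite (splitr e) -(subrKA (g F)).
by rewrite (le_trans (ler_normD _ _))// lerD.
Qed.

Definition completion_space :=
  FunSpace completion_submod completion_bounded completion_closed.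

Lemma completion_emb_subproof u :
  (fun F : dual_ball => sval F u : R^o) \in completion_pred.
Proof. by apply/asboolP => e e0; exists u => F; rewrite subrr normr0 ltW. Qed.

Definition completion_emb u : fun_elt completion_space :=
  @FunElt _ _ completion_space _ (completion_emb_subproof u).

Lemma completion_emb_linear : linear completion_emb.
Proof. by move=> a u v; apply/val_inj/funext => F; rewrite /= linearP. Qed.

HB.instance Definition _ :=
  GRing.isLinear.Build R V (fun_elt completion_space) _ completion_emb
    completion_emb_linear.

Lemma completion_emb_norm u : `|completion_emb u| = p u.
Proof.
rewrite fun_normE; apply/eqP; rewrite eq_le; apply/andP; split.
  by apply: fun_norm_le => [|F]; [exact: seminorm_ge0 | exact: (svalP F)].
have [F [Fu Fp]] := hahn_banach pD pZ u.
have := le_fun_norm (completion_emb u) (exist _ F Fp : dual_ball).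
by rewrite /= Fu ger0_norm// seminorm_ge0.
Qed.

Lemma completion_emb_dense : dense (range completion_emb).
Proof.
move=> O [f Of] oO.
have /nbhs_ballP [e /= e0 eO] := open_nbhs_nbhs (conj oO Of).
have /asboolP /(_ (e / 2)) [|u fu] := fun_eltP f; first by rewrite divr_gt0.
exists (completion_emb u); split; last by exists u.
apply: eO; rewrite -ball_normE /ball_ /= fun_normE.
apply: (@le_lt_trans _ _ (e / 2)).
  by apply: fun_norm_le => [|F]; [rewrite divr_ge0// ltW | exact: fu].
by rewrite ltr_pdivrMr// ltr_pMr// ltr1n.
Qed.

End completion.

(** * The symmetric projective norm *)

Section sym_proj_seminorm.
Variables (R : realType) (N : nat) (Z : normedModType R).
Implicit Types u v : sym_tensor N Z.

Definition sym_rep (n : nat) (l : 'I_n -> R) (x : 'I_n -> Z) : sym_tensor N Z :=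
  \sum_(j < n) l j *: tensor_pow N (x j).

Definition sym_cost (n : nat) (l : 'I_n -> R) (x : 'I_n -> Z) : R :=
  \sum_(j < n) `|l j| * `|x j| ^+ N.

Lemma sym_cost_ge0 n (l : 'I_n -> R) x : 0 <= sym_cost l x.
Proof. by apply: sumr_ge0 => j _; rewrite mulr_ge0// exprn_ge0. Qed.

Lemma sym_repP u : exists n (l : 'I_n -> R) x, u = sym_rep l x.
Proof.
have /asboolP[n [l [x ux]]] := sym_tensorP u.
exists n, l, x; apply/val_inj; rewrite /sym_rep [LHS]ux [RHS]raddf_sum.
by apply: eq_bigr => j _; rewrite [RHS]linearZ.
Qed.

Lemma sym_proj_norm_le n (l : 'I_n -> R) x :
  sym_proj_norm (sym_rep l x) <= sym_cost l x.
Proof.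
apply: ge_inf; last by exists n, l, x.
by exists 0 => _ [m [k [y [_ ->]]]]; exact: sym_cost_ge0.
Qed.

Lemma sym_proj_norm_lt u e : sym_proj_norm u < e ->
  exists n (l : 'I_n -> R) x, u = sym_rep l x /\ sym_cost l x < e.
Proof.
move=> /inf_lt[|_ [n [l [x [-> ->]]]] ce]; last by exists n, l, x.
by have [n [l [x ux]]] := sym_repP u; exists (sym_cost l x), n, l, x.
Qed.

(** Concatenating representations of u and v whose costs are within e / 2 of the infima gives one of
    u + v. *)
Lemma sym_proj_normD u v :
  sym_proj_norm (u + v) <= sym_proj_norm u + sym_proj_norm v.
Proof.
apply/ler_addgt0Pr => e e0.
have e2 : 0 < e / 2 by rewrite divr_gt0.
have [n [l [x [-> lx]]]] : exists n (l : 'I_n -> R) x,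
    u = sym_rep l x /\ sym_cost l x < sym_proj_norm u + e / 2.
  by apply: sym_proj_norm_lt; rewrite ltrDl.
have [m [k [y [-> ky]]]] : exists n (l : 'I_n -> R) x,
    v = sym_rep l x /\ sym_cost l x < sym_proj_norm v + e / 2.
  by apply: sym_proj_norm_lt; rewrite ltrDl.
pose lk (j : 'I_(n + m)) := match fintype.split j with inl i => l i | inr i => k i end.
pose xy (j : 'I_(n + m)) := match fintype.split j with inl i => x i | inr i => y i end.
have splitl (i : 'I_n) : fintype.split (lshift m i) = inl i.
  exact: (unsplitK (inl i)).
have splitr' (i : 'I_m) : fintype.split (rshift n i) = inr i.
  exact: (unsplitK (inr i)).
have -> : sym_rep l x + sym_rep k y = sym_rep lk xy.
  rewrite /sym_rep big_split_ord /= /lk /xy; congr (_ + _).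
    by apply: eq_bigr => i _; rewrite splitl.
  by apply: eq_bigr => i _; rewrite splitr'.
apply: le_trans (sym_proj_norm_le _ _) _.
have -> : sym_cost lk xy = sym_cost l x + sym_cost k y.
  rewrite /sym_cost big_split_ord /= /lk /xy; congr (_ + _).
    by apply: eq_bigr => i _; rewrite splitl.
  by apply: eq_bigr => i _; rewrite splitr'.
move: lx ky; lra.
Qed.

Lemma sym_proj_norm_ge0 u : 0 <= sym_proj_norm u.
Proof.
apply: lb_le_inf => [|_ [m [k [y [_ ->]]]]]; last exact: sym_cost_ge0.
by have [n [l [x ux]]] := sym_repP u; exists (sym_cost l x), n, l, x.
Qed.

Lemma sym_proj_norm_leZ a u : sym_proj_norm (a *: u) <= `|a| * sym_proj_norm u.
Proof.
apply/ler_addgt0Pr => e e0.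
have a1 : 0 < 1 + `|a| by rewrite ltr_pwDl.
have [n [l [x [-> lx]]]] : exists n (l : 'I_n -> R) x,
    u = sym_rep l x /\ sym_cost l x < sym_proj_norm u + e / (1 + `|a|).
  by apply: sym_proj_norm_lt; rewrite ltrDl divr_gt0.
have -> : a *: sym_rep l x = sym_rep (fun j => a * l j) x.
  by rewrite /sym_rep scaler_sumr; apply: eq_bigr => j _; rewrite scalerA.
apply: le_trans (sym_proj_norm_le _ _) _.
have -> : sym_cost (fun j => a * l j) x = `|a| * sym_cost l x.
  by rewrite /sym_cost mulr_sumr; apply: eq_bigr => j _; rewrite normrM mulrA.
apply: le_trans (ler_wpM2l (normr_ge0 _) (ltW lx)) _.
rewrite mulrDr lerD2l mulrCA ler_piMr ?(ltW e0)//.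
by rewrite ler_pdivrMr// mul1r lerDr.
Qed.

Lemma sym_proj_normZ a u : sym_proj_norm (a *: u) = `|a| * sym_proj_norm u.
Proof.
apply/eqP; rewrite eq_le sym_proj_norm_leZ /=.
have [->|a0] := eqVneq a 0; first by rewrite normr0 mul0r sym_proj_norm_ge0.
rewrite -ler_pdivlMl ?normr_gt0// -normfV.
by rewrite -[X in sym_proj_norm X <= _](scalerK a0) sym_proj_norm_leZ.
Qed.

Lemma sym_proj_norm_pow (z : Z) : sym_proj_norm (tensor_pow N z) <= `|z| ^+ N.
Proof.
have := @sym_proj_norm_le 1 (fun=> 1) (fun=> z).
by rewrite /sym_rep /sym_cost !big_ord1 scale1r normr1 mul1r.
Qed.

Lemma sym_proj_norm_sum (I : Type) (r : seq I) (u : I -> sym_tensor N Z) :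
  sym_proj_norm (\sum_(i <- r) u i) <= \sum_(i <- r) sym_proj_norm (u i).
Proof.
elim: r => [|i r ih].
  by rewrite !big_nil (seminorm0 (p := @sym_proj_norm R N Z) sym_proj_normZ).
by rewrite !big_cons (le_trans (sym_proj_normD _ _))// lerD2l.
Qed.

Definition sym_proj_completion : sym_proj_tensor_product N Z :=
  @SymProjTensorProduct R N Z
    (fun_elt (completion_space (@sym_proj_norm R N Z)))
    (completion_emb (@sym_proj_norm R N Z))
    (completion_emb_norm sym_proj_normD sym_proj_normZ)
    (@completion_emb_dense _ _ (@sym_proj_norm R N Z)).

End sym_proj_seminorm.

(** * Bilinear forms on symmetric squares *)

Lemma scale_regE (R : pzRingType) (a : R) (x : R^o) : a *: x = a * x.
Proof. by []. Qed.

Section bilinear.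
Variables (R : realType) (Z : lmodType R).
Implicit Types b : Z -> Z -> R.

Definition bilin b : Prop :=
  (forall y, linear (fun x => b x y : R^o)) /\ (forall x, linear (b x : Z -> R^o)).

Lemma bilinDl b x y z : bilin b -> b (x + y) z = b x z + b y z.
Proof. by case=> + _ => /(_ z 1 x y); rewrite !scale1r. Qed.

Lemma bilinDr b x y z : bilin b -> b z (x + y) = b z x + b z y.
Proof. by case=> _ /(_ z 1 x y); rewrite !scale1r. Qed.

Lemma bilin0l b z : bilin b -> b 0 z = 0.
Proof. by move=> bb; apply: (addrI (b 0 z)); rewrite -bilinDl// !addr0. Qed.

Lemma bilin0r b z : bilin b -> b z 0 = 0.
Proof. by move=> bb; apply: (addrI (b z 0)); rewrite -bilinDr// !addr0. Qed.

Lemma bilinZl b a x z : bilin b -> b (a *: x) z = a * b x z.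
Proof. by move=> bb; case: (bb) => /(_ z a x 0) + _; rewrite addr0 bilin0l// addr0. Qed.

Lemma bilinZr b a x z : bilin b -> b z (a *: x) = a * b z x.
Proof. by move=> bb; case: (bb) => _ /(_ z a x 0); rewrite addr0 bilin0r// addr0. Qed.

Lemma bilinNl b x z : bilin b -> b (- x) z = - b x z.
Proof. by move=> bb; rewrite -scaleN1r bilinZl// mulN1r. Qed.

Lemma bilinNr b x z : bilin b -> b z (- x) = - b z x.
Proof. by move=> bb; rewrite -scaleN1r bilinZr// mulN1r. Qed.

Lemma bilin_suml b (I : Type) (r : seq I) (P : pred I) (x : I -> Z) z : bilin b ->
  b (\sum_(i <- r | P i) x i) z = \sum_(i <- r | P i) b (x i) z.
Proof.
move=> bb; apply: (big_morph (b^~ z)) => [u v|]; first exact: bilinDl.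
exact: bilin0l.
Qed.

Lemma bilin_sumr b (I : Type) (r : seq I) (P : pred I) (x : I -> Z) z : bilin b ->
  b z (\sum_(i <- r | P i) x i) = \sum_(i <- r | P i) b z (x i).
Proof.
move=> bb; apply: (big_morph (b z)) => [u v|]; first exact: bilinDr.
exact: bilin0r.
Qed.

Lemma bilin_mul (f g : Z -> R) : linear (f : Z -> R^o) -> linear (g : Z -> R^o) ->
  bilin (fun x y => f x * g y).
Proof.
move=> fl gl; split=> [y a u v|x a u v].
  by rewrite fl !scale_regE mulrDl mulrA.
by rewrite gl !scale_regE mulrDr mulrCA.
Qed.

Lemma bilinB b c : bilin b -> bilin c -> bilin (fun x y => b x y - c x y).
Proof.
move=> [bl br] [cl cr]; split=> [y a u v|x a u v].
  by rewrite bl cl scalerBr opprD addrACA.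
by rewrite br cr scalerBr opprD addrACA.
Qed.

Lemma bilin_sum (I : Type) (r : seq I) (P : pred I) (c : I -> Z -> Z -> R) :
  (forall i, bilin (c i)) -> bilin (fun x y => \sum_(i <- r | P i) c i x y).
Proof.
move=> cb; split=> [y a u v|x a u v]; rewrite scaler_sumr -big_split /=.
  by apply: eq_bigr => i _; rewrite (cb i).1.
by apply: eq_bigr => i _; rewrite (cb i).2.
Qed.

Lemma bilinZ b a : bilin b -> bilin (fun x y => a * b x y).
Proof.
move=> bb; split=> [y c u v|x c u v].
  by rewrite (bilinDl _ _ _ bb) (bilinZl _ _ _ bb) mulrDr mulrCA.
by rewrite (bilinDr _ _ _ bb) (bilinZr _ _ _ bb) mulrDr mulrCA.
Qed.

Lemma multilinear_of_bilin b : bilin b ->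
  multilinear (fun z : 'I_2 -> Z => b (z ord0) (z ord_max) : R^o).
Proof.
move=> [bl br] z i a x y.
case: (unliftP ord0 i) => [j ->|->]; last first.
  by rewrite /= !dfwithin !dfwithout// bl.
have -> : lift ord0 j = ord_max by apply/val_inj; rewrite /= ord1.
by rewrite /= !dfwithin !dfwithout// br.
Qed.

(** The functional z (x) z |-> b z z. It is well defined because tensors are functionals on the
    multilinear forms. *)
Definition quad_eval b (bb : bilin b) (u : sym_tensor 2 Z) : R^o :=
  (u : tensor_space 2 Z) (MultilinearForm (multilinear_of_bilin bb)).

Lemma quad_eval_linear b (bb : bilin b) : linear (quad_eval bb).
Proof. by []. Qed.

HB.instance Definition _ b (bb : bilin b) :=
  GRing.isLinear.Build R (sym_tensor 2 Z) R^o _ (quad_eval bb) (quad_eval_linear bb).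

Lemma quad_evalE b (bb : bilin b) z : quad_eval bb (tensor_pow 2 z) = b z z.
Proof. by []. Qed.

Lemma bilin_of_multilinear (B : multilinear_form 2 Z) :
  bilin (fun x y => B (fun i => if i == ord0 then x else y)).
Proof.
split=> [y a u v|x a u v].
  have h w : (fun i : 'I_2 => if i == ord0 then w else y) =
      dfwith (fun=> y) ord0 w.
    apply/funext => i; case: eqP => [->|/eqP i0]; first by rewrite dfwithin.
    by rewrite dfwithout// eq_sym.
  by rewrite !h (mformP B).
have h w : (fun i : 'I_2 => if i == ord0 then x else w) =
    dfwith (fun=> x) ord_max w.
  apply/funext => i; case: eqP => [->|/eqP i0]; first by rewrite dfwithout.
  have -> : i = ord_max.
    by apply/val_inj; move: i i0 => [[|[|]]].
  by rewrite dfwithin.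
by rewrite !h (mformP B).
Qed.

Lemma tensor_pow2E (B : multilinear_form 2 Z) z :
  (tensor_pow 2 z : tensor_space 2 Z) B = B (fun i => if i == ord0 then z else z).
Proof. by congr (B _); apply/funext => i; rewrite if_same. Qed.

(** This is x (x) y + y (x) x, written with squares so as to be visibly a symmetric tensor. *)
Definition tensor_sym (x y : Z) : sym_tensor 2 Z :=
  tensor_pow 2 (x + y) - tensor_pow 2 x - tensor_pow 2 y.

Lemma tensor_symE x y (B : multilinear_form 2 Z) :
  (tensor_sym x y : tensor_space 2 Z) B =
  B (fun i => if i == ord0 then x else y) + B (fun i => if i == ord0 then y else x).
Proof.
pose m x y := B (fun i => if i == ord0 then x else y).
have bB : bilin m by exact: bilin_of_multilinear.
have -> : (tensor_sym x y : tensor_space 2 Z) B = m (x + y) (x + y) - m x x - m y y.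
  by rewrite /m -!tensor_pow2E.
by rewrite -[RHS]/(m x y + m y x) (bilinDl _ _ _ bB) !(bilinDr _ _ _ bB); ring.
Qed.

Lemma tensor_symC x y : tensor_sym x y = tensor_sym y x.
Proof. by rewrite /tensor_sym addrAC (addrC x). Qed.

Lemma tensor_sym_linear y : linear (tensor_sym^~ y).
Proof.
move=> a u v; apply/val_inj/funext => B.
pose m x y := B (fun i => if i == ord0 then x else y).
have bB : bilin m by exact: bilin_of_multilinear.
transitivity (a * (tensor_sym u y : tensor_space 2 Z) B
  + (tensor_sym v y : tensor_space 2 Z) B) => //.
have E s t : (tensor_sym s t : tensor_space 2 Z) B = m s t + m t s.
  exact: tensor_symE.
rewrite [LHS]E !E (bilinDl _ _ _ bB) (bilinDr _ _ _ bB).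
rewrite (bilinZl _ _ _ bB) (bilinZr _ _ _ bB); ring.
Qed.

Lemma tensor_sym0l y : tensor_sym 0 y = 0.
Proof. by have := tensor_sym_linear y (-1) 0 0; rewrite scaler0 addr0 scaleN1r addNr. Qed.

Lemma tensor_sym_suml (I : Type) (r : seq I) (x : I -> Z) y :
  \sum_(i <- r) tensor_sym (x i) y = tensor_sym (\sum_(i <- r) x i) y.
Proof.
apply/esym/(big_morph (tensor_sym^~ y)) => [u v|].
  by have := tensor_sym_linear y 1 u v; rewrite !scale1r.
exact: tensor_sym0l.
Qed.

Section polar.
Variable F : {linear sym_tensor 2 Z -> R^o}.

(** The symmetric bilinear form with diagonal z |-> F (z (x) z); the factor 1/2 compensates for
    [tensor_sym z z] being twice the square. *)
Definition polar (x y : Z) : R := 2^-1 * F (tensor_sym x y).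

Lemma polarC x y : polar x y = polar y x.
Proof. by rewrite /polar tensor_symC. Qed.

Lemma polar_bilin : bilin polar.
Proof.
have h y : linear ((fun x => polar x y) : Z -> R^o).
  move=> a u v; rewrite /polar tensor_sym_linear linearP /= !scale_regE; ring.
split=> // x a u v; rewrite !(polarC x); exact: h.
Qed.

Lemma polar_diag z : polar z z = F (tensor_pow 2 z).
Proof.
rewrite /polar; suff -> : tensor_sym z z = 2 *: tensor_pow 2 z.
  by rewrite linearZ /= scale_regE mulrA mulVf ?mul1r.
apply/val_inj/funext => B.
transitivity (2 * (tensor_pow 2 z : tensor_space 2 Z) B) => //.
by rewrite [LHS]tensor_symE tensor_pow2E mulr_natl.
Qed.

End polar.

End bilinear.

(** For |w| = |x|, the identity 4 b(x,w) = b(x+w,x+w) - b(x-w,x-w) gives |b(x,w)| <= 2 K |x|^2. The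
    general case follows by rescaling y to the norm of x. *)
Lemma bilin_bound (R : realType) (Z : normedModType R) (b : Z -> Z -> R) K :
  bilin b -> (forall x y, b x y = b y x) -> (forall z, `|b z z| <= K * `|z| ^+ 2) ->
  forall x y, `|b x y| <= 2 * K * `|x| * `|y|.
Proof.
move=> bb bC bK x y.
have [->|x0] := eqVneq x 0; first by rewrite (bilin0l _ bb) !normr0 mulr0 mul0r.
have [->|y0] := eqVneq y 0; first by rewrite (bilin0r _ bb) !normr0 mulr0.
have K0 : 0 <= K.
  by rewrite -(@pmulr_lge0 _ (`|x| ^+ 2)) ?exprn_gt0 ?normr_gt0// (le_trans _ (bK x)).
have x1 : 0 < `|x| by rewrite normr_gt0.
have y1 : 0 < `|y| by rewrite normr_gt0.
have key w : `|w| = `|x| -> `|b x w| <= 2 * K * `|x| ^+ 2.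
  move=> wx.
  have E : 4 * b x w = b (x + w) (x + w) - b (x - w) (x - w).
    rewrite !(bilinDl _ _ _ bb, bilinDr _ _ _ bb) !(bilinNl _ _ bb, bilinNr _ _ bb).
    by rewrite (bC w x); ring.
  have h s : `|s| = `|x| -> `|b (x + s) (x + s)| <= 4 * K * `|x| ^+ 2.
    move=> sx; apply: le_trans (bK _) _.
    have : `|x + s| ^+ 2 <= (2 * `|x|) ^+ 2.
      rewrite lerXn2r ?nnegrE ?mulr_ge0//.
      by rewrite (le_trans (ler_normD _ _))// sx mulr_natl mulr2n.
    by move=> /(ler_wpM2l K0) /le_trans; apply; rewrite exprMn; lra.
  have : `|4 * b x w| <= 8 * K * `|x| ^+ 2.
    rewrite E (le_trans (ler_normB _ _))//.
    by have := h _ wx; have := h (- w); rewrite normrN => /(_ wx); lra.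
  by rewrite normrM ger0_norm//; lra.
have := key ((`|x| / `|y|) *: y).
rewrite normrZ ger0_norm ?divr_ge0// mulfVK ?gt_eqF// => /(_ erefl).
rewrite (bilinZr _ _ _ bb) normrM ger0_norm ?divr_ge0//.
rewrite mulrAC ler_pdivrMr// expr2 => h.
by rewrite -(ler_pM2l x1); apply: le_trans h _; rewrite le_eqVlt; apply/orP; left; apply/eqP; ring.
Qed.

(** * Forms vanishing at a norm-one tensor *)

Lemma cvg_sumr (R : realType) (I T : Type) (F : set_system T) (r : seq I)
    (f : I -> T -> R) (l : I -> R) : Filter F ->
  (forall i, f i @ F --> l i) ->
  (fun t => \sum_(i <- r) f i t) @ F --> \sum_(i <- r) l i.
Proof.
move=> FF fl; elim: r => [|i r ih].
  by rewrite big_nil; under eq_fun do rewrite big_nil; exact: cvg_cst.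
by rewrite big_cons; under eq_fun do rewrite big_cons; exact: cvgD.
Qed.

Section null_forms.
Variables (R : realType) (Z : normedModType R).
Let p := @sym_proj_norm R 2 Z.
Let pD : forall u v, p (u + v) <= p u + p v := @sym_proj_normD R 2 Z.
Let pZ : forall a u, p (a *: u) = `|a| * p u := @sym_proj_normZ R 2 Z.
Variable g : fun_elt (completion_space p).
Hypothesis g1 : `|g| <= 1.
Implicit Types q : Z -> R.

(** Here q is an arbitrary function, so the sum may depend on the representation and not only on the
    tensor. *)
Definition qsum n (l : 'I_n -> R) (x : 'I_n -> Z) q : R :=
  \sum_(j < n) l j * q (x j).

Lemma linear_sym_rep (F : {linear sym_tensor 2 Z -> R^o}) n (l : 'I_n -> R) x :
  F (sym_rep 2 l x) = qsum l x (fun z => F (tensor_pow 2 z)).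
Proof. by rewrite linear_sum; apply: eq_bigr => j _; rewrite linearZ. Qed.

Lemma linear_bound (F : {linear sym_tensor 2 Z -> R^o}) K : 0 <= K ->
  (forall z, `|F (tensor_pow 2 z)| <= K * `|z| ^+ 2) ->
  forall u, `|F u| <= K * p u.
Proof.
move=> K0 FK u; apply/ler_addgt0Pr => e e0.
have K1 : 0 < 1 + K by rewrite ltr_pwDl.
have [n [l [x [-> lx]]]] : exists n (l : 'I_n -> R) x,
    u = sym_rep 2 l x /\ sym_cost 2 l x < p u + e / (1 + K).
  by apply: sym_proj_norm_lt; rewrite ltrDl divr_gt0.
rewrite linear_sym_rep /qsum.
apply: le_trans (ler_norm_sum _ _ _) _.
apply: (@le_trans _ _ (K * sym_cost 2 l x)).
  rewrite /sym_cost mulr_sumr ler_sum// => j _.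
  by rewrite normrM mulrCA ler_wpM2l.
apply: le_trans (ler_wpM2l K0 (ltW lx)) _.
rewrite mulrDr lerD2l mulrCA ler_piMr ?(ltW e0)//.
by rewrite ler_pdivrMr// mul1r lerDr.
Qed.

(** A representation of almost minimal cost of a tensor within d of g; the second condition is this
    distance in the completion. *)
Definition near_rep d n (l : 'I_n -> R) x : Prop :=
  sym_cost 2 l x <= 1 + d /\
  forall F : dual_ball p, `|g F - sval F (sym_rep 2 l x)| <= d.

Lemma near_rep_ex d : 0 < d -> exists n (l : 'I_n -> R) x, near_rep d l x.
Proof.
move=> d0; have d2 : 0 < d / 2 by rewrite divr_gt0.
have /asboolP /(_ _ d2)[u gu] := fun_eltP g.
have : p u < 1 + d.
  rewrite -(completion_emb_norm pD pZ) -[completion_emb _ _](subrK g).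
  rewrite addrC (le_lt_trans (ler_normD _ _))// (@le_lt_trans _ _ (1 + d / 2))//.
    rewrite lerD// distrC fun_normE.
    by apply: fun_norm_le => [|F]; [exact: ltW | exact: gu].
  by rewrite ltrD2l ltr_pdivrMr// ltr_pMr// ltr1n.
move=> /sym_proj_norm_lt[n [l [x [ux lx]]]]; exists n, l, x; split; first exact: ltW.
by move=> F; rewrite -ux (le_trans (gu F))// ler_pdivrMr// ler_peMr ?ler1n ?ltW.
Qed.

Lemma near_rep_le d d' n (l : 'I_n -> R) x : d <= d' ->
  near_rep d l x -> near_rep d' l x.
Proof.
move=> dd [lx gF]; split; first by rewrite (le_trans lx)// lerD2l.
by move=> F; exact: le_trans (gF F) dd.
Qed.

Lemma near_rep_dist d n (l : 'I_n -> R) x m (k : 'I_m -> R) y :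
  near_rep d l x -> near_rep d k y ->
  p (sym_rep 2 l x - sym_rep 2 k y) <= 2 * d.
Proof.
move=> [lx gx] [ky gy].
(* The zero functional lies in the dual ball, so the second condition is not void. *)
have d0 : 0 <= d.
  have F0 (u : sym_tensor 2 Z) : `|(\0 : {linear sym_tensor 2 Z -> R^o}) u| <= p u.
    by rewrite normr0 seminorm_ge0.
  by apply: le_trans (gx (exist _ _ F0)).
rewrite -(completion_emb_norm pD pZ) fun_normE fun_norm_le ?mulr_ge0// => F.
rewrite /= linearB /= -(subrKA (g F)) mulr_natl mulr2n.
by rewrite (le_trans (ler_normD _ _))// lerD// distrC.
Qed.

(* Read as the functional z (x) z |-> q z, the function [q] vanishes at [g]. *)
Definition null q : Prop := forall e, 0 < e -> exists2 d, 0 < d &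
  forall n (l : 'I_n -> R) x, near_rep d l x -> `|qsum l x q| <= e.

Lemma null_ext q q' : q =1 q' -> null q -> null q'.
Proof. by move=> /funext ->. Qed.

Lemma nullD q q' : null q -> null q' -> null (fun z => q z + q' z).
Proof.
move=> nq nq' e e0; have e2 : 0 < e / 2 by rewrite divr_gt0.
have [d d0 qd] := nq _ e2; have [d' d'0 qd'] := nq' _ e2.
exists (Num.min d d'); first by rewrite lt_min d0.
move=> n l x nlx; have -> : qsum l x (fun z => q z + q' z) = qsum l x q + qsum l x q'.
  by rewrite /qsum -big_split; apply: eq_bigr => j _; rewrite mulrDr.
rewrite (splitr e) (le_trans (ler_normD _ _))// lerD//.
  by apply: qd; apply: near_rep_le nlx; rewrite ge_min lexx.
by apply: qd'; apply: near_rep_le nlx; rewrite ge_min lexx orbT.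
Qed.

Lemma nullZ a q : null q -> null (fun z => a * q z).
Proof.
move=> nq e e0; have a1 : 0 < 1 + `|a| by rewrite ltr_pwDl.
have [d d0 qd] := nq _ (divr_gt0 e0 a1); exists d => // n l x /qd qe.
have -> : qsum l x (fun z => a * q z) = a * qsum l x q.
  by rewrite /qsum mulr_sumr; apply: eq_bigr => j _; rewrite mulrCA.
rewrite normrM (le_trans (ler_wpM2l _ qe))// mulrCA ler_piMr ?(ltW e0)//.
by rewrite ler_pdivrMr// mul1r lerDr.
Qed.

Lemma null0 : null (fun=> 0).
Proof.
move=> e e0; exists 1 => // n l x _; rewrite /qsum big1 ?normr0 ?(ltW e0)// => j _.
by rewrite mulr0.
Qed.

Lemma null_sum (I : Type) (r : seq I) (q : I -> Z -> R) :
  (forall i, null (q i)) -> null (fun z => \sum_(i <- r) q i z).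
Proof.
move=> nq; elim: r => [|i r ih].
  by apply: null_ext null0 => z; rewrite big_nil.
by apply: null_ext (nullD (nq i) ih) => z; rewrite big_cons.
Qed.

(* All representations near [g] are close to one another in the symmetric
   projective norm, so it suffices to have convergence on a single one. *)
Lemma null_lim (b : Z -> Z -> R) (b_ : nat -> Z -> Z -> R) K :
  bilin b -> (forall m, bilin (b_ m)) ->
  (forall m z, `|b z z - b_ m z z| <= K * `|z| ^+ 2) ->
  (forall z, (fun m => b_ m z z) @ \oo --> b z z) ->
  (forall m, null (fun z => b_ m z z)) -> null (fun z => b z z).
Proof.
move=> bb bb_ bK b_b nb_ e e0.
have bbB m : bilin (fun x y => b x y - b_ m x y) := bilinB bb (bb_ m).
have bbE m n (l : 'I_n -> R) x :
    quad_eval (bbB m) (sym_rep 2 l x) = qsum l x (fun z => b z z) - qsum l x (fun z => b_ m z z).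
  by rewrite linear_sym_rep /qsum -sumrB; apply: eq_bigr => j _; rewrite mulrBr.
have K1 : 0 < 1 + `|K| by rewrite ltr_pwDl.
(* Two [near_rep d0] tensors are at distance at most 2 d0, and b - b_m is bounded by 1 + |K|; so
   their values under it differ by at most e / 4, whatever m is. *)
pose d0 := e / (1 + `|K|) / 8.
have d00 : 0 < d0 by rewrite !divr_gt0.
have [n0 [l0 [x0 near0]]] := near_rep_ex d00.
have : (fun m => qsum l0 x0 (fun z => b_ m z z)) @ \oo --> qsum l0 x0 (fun z => b z z).
  by apply: cvg_sumr => j; apply: cvgM; [exact: cvg_cst | exact: b_b].
have e4 : 0 < e / 4 by rewrite divr_gt0.
move=> /cvgrPdist_le /(_ _ e4)[m _ /(_ m (leqnn m)) /= bm].
have [d1 d10 nd1] := nb_ m _ e4.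
exists (Num.min d0 d1); first by rewrite lt_min d00.
move=> n l x nlx.
have nd0 : near_rep d0 l x by apply: near_rep_le nlx; rewrite ge_min lexx.
have {}nd1 : `|qsum l x (fun z => b_ m z z)| <= e / 4.
  by apply: nd1; apply: near_rep_le nlx; rewrite ge_min lexx orbT.
have dist : `|quad_eval (bbB m) (sym_rep 2 l x - sym_rep 2 l0 x0)| <= e / 4.
  apply: le_trans (linear_bound (K := 1 + `|K|) (ltW K1) _ _) _.
    move=> z; apply: le_trans (bK m z) _; rewrite ler_wpM2r ?exprn_ge0//.
    by rewrite (le_trans (ler_norm _))// lerDr.
  apply: le_trans (ler_wpM2l (ltW K1) (near_rep_dist nd0 near0)) _.
  rewrite /d0 le_eqVlt; apply/orP; left; apply/eqP; field.
  by rewrite gt_eqF.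
move: dist; rewrite linearB /= !bbE.
move: bm nd1; rewrite !ler_norml => /andP[? ?] /andP[? ?] /andP[? ?].
apply/andP; split; lra.
Qed.

Section norming.
Variables (P : Z -> Z -> R) (Pb : bilin P).
Hypothesis P1 : forall u, `|quad_eval Pb u| <= p u.
Hypothesis gP : g (exist _ (quad_eval Pb : {linear _ -> _}) P1) = 1.

Lemma norming_le z : `|P z z| <= `|z| ^+ 2.
Proof.
rewrite -(quad_evalE Pb); apply: le_trans (P1 _) _; exact: sym_proj_norm_pow.
Qed.

(** As P(g) = 1 and the cost is at most 1 + d, the weighted sum of the defects |z|^2 - |P(z)| over a
    near representation is at most 2 d. Up to a constant, |q| is below the geometric mean of |z|^2
    and the defect, so its weighted sum is small too. *)
Lemma null_dominated q C : 0 <= C ->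
  (forall z, q z ^+ 2 <= C * `|z| ^+ 2 * (`|z| ^+ 2 - `|P z z|)) -> null q.
Proof.
move=> C0 qC e e0.
pose c := C / e.
have c0 : 0 <= c by rewrite divr_ge0// ltW.
have cC : c * e = C by rewrite /c divfK// gt_eqF.
(* AM-GM *)
have qc z : `|q z| <= e / 4 * `|z| ^+ 2 + c * (`|z| ^+ 2 - `|P z z|).
  have D0 : 0 <= `|z| ^+ 2 - `|P z z| by rewrite subr_ge0 norming_le.
  have M0 : 0 <= `|z| ^+ 2 by rewrite exprn_ge0.
  have eM : 0 <= e / 4 * `|z| ^+ 2 by rewrite mulr_ge0// divr_ge0// ltW.
  have cD : 0 <= c * (`|z| ^+ 2 - `|P z z|) by rewrite mulr_ge0.
  rewrite -(@ler_pXn2r _ 2) ?nnegrE ?addr_ge0// real_normK ?num_real//.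
  apply: le_trans (qC z) _; rewrite -cC.
  have : 0 <= (e / 4 * `|z| ^+ 2 - c * (`|z| ^+ 2 - `|P z z|)) ^+ 2 by rewrite sqr_ge0.
  set M := `|z| ^+ 2; set D := M - _.
  have -> : c * e * M * D = 4 * (e / 4 * M) * (c * D) by field.
  set s := e / 4 * M; set t := c * D; nra.
have c1 : 0 < 1 + c by rewrite ltr_pwDl.
(* The bounds d <= 1 and c d <= e / 4 make each of the two terms from AM-GM contribute at most e /
   2. *)
exists (Num.min 1 (e / (4 * (1 + c)))).
  by rewrite lt_min ltr01 divr_gt0// mulr_gt0.
set d := Num.min _ _; move=> n l x [lx gF].
have d1 : d <= 1 by rewrite ge_min lexx.
have dc : c * d <= e / 4.
  have : d <= e / (4 * (1 + c)) by rewrite ge_min lexx orbT.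
  rewrite ler_pdivlMr ?mulr_gt0// => h.
  have : 0 <= d by rewrite le_min ler01 divr_ge0 ?(ltW e0)// mulr_ge0// ltW.
  lra.
have := gF (exist _ (quad_eval Pb : {linear _ -> _}) P1); rewrite gP /=.
rewrite linear_sym_rep /= => /ler_normlW Pd.
have lP : 1 - d <= \sum_(j < n) `|l j| * `|P (x j) (x j)|.
  apply: (@le_trans _ _ (qsum l x (fun z => P z z))).
    by rewrite lerBlDr -lerBlDl.
  apply: le_trans (ler_norm _) _; apply: le_trans (ler_norm_sum _ _ _) _.
  by apply: ler_sum => j _; rewrite normrM.
apply: le_trans (ler_norm_sum _ _ _) _.
apply: (@le_trans _ _ (e / 4 * sym_cost 2 l x +
    c * (sym_cost 2 l x - \sum_(j < n) `|l j| * `|P (x j) (x j)|))).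
  rewrite /sym_cost -sumrB !mulr_sumr -big_split /= ler_sum// => j _.
  rewrite normrM; apply: le_trans (ler_wpM2l (normr_ge0 _) (qc (x j))) _.
  by rewrite le_eqVlt; apply/orP; left; apply/eqP; ring.
have h1 : e / 4 * sym_cost 2 l x <= e / 4 * 2.
  by rewrite ler_pM2l ?divr_gt0//; move: lx d1; lra.
have h2 : c * (sym_cost 2 l x - \sum_(j < n) `|l j| * `|P (x j) (x j)|) <= c * (2 * d).
  by rewrite ler_wpM2l//; move: lx lP; lra.
move: h1 h2 dc; lra.
Qed.

End norming.

End null_forms.

(** * The example *)

(* [inl (b, i)] is the coordinate u_(b,i) and [inr (true, n)] the coordinate
   y_n. The coordinate [inr (false, n)] is r_n := sum_k 2^-(k+1) y_(n+k), so
   that y_n = 2 r_n - r_(n+1), s = r_0 and |r_n| <= sup_k |y_k|: it does not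
   change the norm but avoids the series. *)
Definition ex_index : Type := (bool * 'I_3 + bool * nat)%type.

Section example_space.
Variable R : realType.

(** Since r_n tends to 0, iterating r_n = (y_n + r_(n+1)) / 2 yields the series for r_n, and y_n
    tends to 0 as well: this is the subspace of c_0 described above. *)
Definition Zpred : {pred ex_index -> R^o} := fun f =>
  `[< [/\ forall b, \sum_i f (inl (b, i)) = f (inr (false, 0)),
          forall n, f (inr (true, n)) = 2 * f (inr (false, n)) - f (inr (false, n.+1)) &
          (fun n => f (inr (false, n))) @ \oo --> (0 : R)] >].

Lemma Zpred_submod : GRing.submod_closed Zpred.
Proof.
split=> [|a f g /asboolP[fu fy fr] /asboolP[gu gy gr]]; apply/asboolP; split.
- by move=> b; rewrite big1.
- by move=> n; rewrite /= mulr0 subr0.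
- exact: cvg_cst.
- move=> b; transitivity (a * \sum_i f (inl (b, i)) + \sum_i g (inl (b, i))).
    by rewrite mulr_sumr -big_split.
  by rewrite fu gu.
- move=> n; transitivity (a * f (inr (true, n)) + g (inr (true, n))) => //.
  transitivity (2 * (a * f (inr (false, n)) + g (inr (false, n)))
    - (a * f (inr (false, n.+1)) + g (inr (false, n.+1)))) => //.
  by rewrite fy gy; ring.
- have -> : (0 : R) = a * 0 + 0 by rewrite mulr0 addr0.
  by apply: cvgD => //; apply: cvgM => //; exact: cvg_cst.
Qed.

Lemma Zpred_bounded f : f \in Zpred -> exists M, forall x, `|f x| <= M.
Proof.
move=> /asboolP[fu fy fr].
have [M [_ /(_ (M + 1))]] := cvg_seq_bounded (cvgP _ fr).
rewrite ltrDl ltr01 => /(_ isT) fM.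
have rM n : `|f (inr (false, n))| <= M + 1 by exact: (fM n I).
have M0 : 0 <= M + 1 by exact: le_trans (rM 0).
exists (3 * (M + 1) + \sum_b \sum_i `|f (inl (b, i))|).
have S0 : 0 <= \sum_b \sum_i `|f (inl (b, i))| by apply: sumr_ge0 => b _; apply: sumr_ge0.
move=> [[b i]|[[] n]].
- apply: le_trans (_ : \sum_b \sum_i `|f (inl (b, i))| <= _).
    rewrite (bigD1 b)//= (bigD1 i)//= -addrA lerDl addr_ge0 ?sumr_ge0// => c _.
    by rewrite sumr_ge0.
  by rewrite lerDr mulr_ge0.
- rewrite fy (le_trans (ler_normB _ _))// normrM ger0_norm//.
  by have := rM n; have := rM n.+1; move: S0; lra.
- by rewrite (le_trans (rM n))//; move: S0 M0; lra.
Qed.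

Lemma Zpred_closed f :
  (forall e, 0 < e -> exists2 g, g \in Zpred & forall x, `|f x - g x| <= e) ->
  f \in Zpred.
Proof.
move=> fg; apply/asboolP.
have small (x y : R) (C : R) : (forall e, 0 < e -> `|x - y| <= C * e) -> x = y.
  move=> xy; apply/eqP; rewrite -subr_eq0 -normr_le0; apply/ler_addgt0Pr => e e0.
  have C1 : 0 < 1 + `|C| by rewrite ltr_pwDl.
  have := xy _ (divr_gt0 e0 C1) => /le_trans; apply.
  rewrite add0r mulrCA ler_piMr ?(ltW e0)// ler_pdivrMr// mul1r.
  by rewrite (le_trans (ler_norm _))// lerDr.
split.
(* The constant 4 counts the three u_(b,i) and r_0; for y_n below it is 1 + 2 + 1. *)
- move=> b; apply: (small _ _ 4) => e e0.
  have [g /asboolP[gu _ _] {}fg] := fg _ e0.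
  have -> : \sum_i f (inl (b, i)) - f (inr (false, 0)) =
      \sum_i (f (inl (b, i)) - g (inl (b, i))) - (f (inr (false, 0)) - g (inr (false, 0))).
    by rewrite sumrB gu; ring.
  rewrite (le_trans (ler_normB _ _))// (_ : 4 * e = 3 * e + e); last by ring.
  rewrite lerD// (le_trans (ler_norm_sum _ _ _))//.
  rewrite (le_trans (ler_sum _ (fun i _ => fg (inl (b, i)))))//.
  by rewrite sumr_const card_ord mulr_natl.
- move=> n; apply: (small _ _ 4) => e e0.
  have [g /asboolP[_ gy _] {}fg] := fg _ e0.
  have := fg (inr (true, n)); have := fg (inr (false, n)); have := fg (inr (false, n.+1)).
  rewrite gy !ler_norml => /andP[? ?] /andP[? ?] /andP[? ?].
  by apply/andP; split; lra.
- apply/cvgrPdist_le => e e0; have e2 : 0 < e / 2 by rewrite divr_gt0.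
  have [g /asboolP[_ _ /cvgrPdist_le /(_ _ e2) gr] {}fg] := fg _ e2.
  apply: filterS gr => n /=; rewrite !sub0r !normrN => gn.
  rewrite (splitr e) -[f _](subrK (g (inr (false, n)))).
  by rewrite (le_trans (ler_normD _ _))// lerD.
Qed.

Definition Zspace := FunSpace Zpred_submod Zpred_bounded Zpred_closed.
Definition exZ := fun_elt Zspace.
Implicit Types z : exZ.

Definition zs z : R := z (inr (false, 0)).
Definition zr n z : R := z (inr (false, n)).
Definition zu b i z : R := z (inl (b, i)).
Definition tau b i z : R := 2^-1 * (zs z - zu b i z).

Lemma zr_linear n : linear (zr n : exZ -> R^o). Proof. by []. Qed.
Lemma zu_linear b i : linear (zu b i : exZ -> R^o). Proof. by []. Qed.

Lemma tau_linear b i : linear (tau b i : exZ -> R^o).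
Proof.
move=> a x y; rewrite /tau /zs -!/(zr 0 _) zr_linear zu_linear !scale_regE; ring.
Qed.

Lemma exZP z : [/\ forall b, \sum_i zu b i z = zs z,
  forall n, z (inr (true, n)) = 2 * zr n z - zr n.+1 z & (zr ^~ z) @ \oo --> (0 : R)].
Proof. by have /asboolP := fun_eltP z. Qed.

Lemma sum_tau b z : \sum_i tau b i z = zs z.
Proof.
have [zu_sum _ _] := exZP z.
rewrite /tau -mulr_sumr sumrB zu_sum sumr_const card_ord; lra.
Qed.

Lemma le_coord z x : `|z x| <= `|z|.
Proof. exact: le_fun_norm. Qed.

Lemma zr_le n z : `|zr n z| <= `|z|. Proof. exact: le_coord. Qed.

(* Since [zu b i = zs - 2 * tau b i], up to sign the four
   functionals [zs] and [zu b i]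
   have the values [+-tau b 0 +- tau b 1 +- tau b 2]. *)
Lemma sum_norm_tau b z : \sum_i `|tau b i z| <= `|z|.
Proof.
have := sum_tau b z; have : `|zs z| <= `|z| := zr_le 0 z.
have h i : `|zs z - 2 * tau b i z| <= `|z|.
  by rewrite /tau mulrA mulfV// mul1r opprB addrCA subrr addr0; exact: le_coord.
move: (h ord0) (h (lift ord0 ord0)) (h (lift ord0 (lift ord0 ord0))).
rewrite !big_ord_recl !big_ord0 !addr0.
set a0 := tau b ord0 z; set a1 := tau b _ z; set a2 := tau b _ z.
rewrite !ler_norml => /andP[? ?] /andP[? ?] /andP[? ?] /andP[? ?] ?.
by case: (ger0P a0); case: (ger0P a1); case: (ger0P a2) => *; lra.
Qed.

End example_space.

Arguments zs {R} z : simpl never.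
Arguments zr {R} n z : simpl never.
Arguments zu {R} b i z : simpl never.
Arguments tau {R} b i z : simpl never.

Lemma ord3_ind (T : 'I_3 -> Prop) : T ord0 -> T (lift ord0 ord0) ->
  T (lift ord0 (lift ord0 ord0)) -> forall i, T i.
Proof.
move=> T0 T1 T2 i; case: (unliftP ord0 i) => [j ->|-> //].
by case: (unliftP ord0 j) => [k ->|-> //]; rewrite ord1.
Qed.

Definition sgb (R : realType) (b : bool) : R := if b then 1 else -1.
Arguments sgb {R} b.

(** * The form P and estimates by its defect *)

Section example_form.
Variable R : realType.
Implicit Types z : exZ R.

Definition sqtau b z : R := \sum_i tau b i z ^+ 2.

Definition exP (x y : exZ R) : R :=
  3 / 2 * \sum_i (tau true i x * tau true i y - tau false i x * tau false i y).

Lemma exP_bilin : bilin exP.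
Proof.
apply: bilinZ; apply: bilin_sum => i.
by apply: bilinB; apply: bilin_mul; exact: tau_linear.
Qed.

Lemma exP_diag b z : exP z z = sgb b * (3 / 2 * (sqtau b z - sqtau (~~ b) z)).
Proof. by case: b; rewrite /exP sumrB /sqtau /sgb /=; ring. Qed.

Lemma sqr_zs_le z : zs z ^+ 2 <= `|z| ^+ 2.
Proof. by rewrite -[zs z ^+ 2]real_normK ?num_real// lerXn2r ?nnegrE// zr_le. Qed.

Let sqr_sum_norm_tau b z : (\sum_i `|tau b i z|) ^+ 2 <= `|z| ^+ 2.
Proof. by rewrite lerXn2r ?nnegrE ?sumr_ge0// sum_norm_tau. Qed.

(** With t_i = tau_(b,i), the difference is at least (sum |t_i|)^2 + (sum t_i)^2 - 2 sum t_i^2,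
    which is twice the sum over pairs of |t_i t_j| + t_i t_j. *)
Lemma sqtau_le b z : 2 * sqtau b z <= `|z| ^+ 2 + zs z ^+ 2.
Proof.
apply: le_trans (_ : (\sum_i `|tau b i z|) ^+ 2 + zs z ^+ 2 <= _); last first.
  by rewrite lerD2r sqr_sum_norm_tau.
rewrite -(sum_tau b z) /sqtau !big_ord_recl !big_ord0 !addr0.
set a0 := tau b ord0 z; set a1 := tau b _ z; set a2 := tau b _ z.
have h (x y : R) : - (x * y) <= `|x| * `|y| by rewrite -normrM -lerNl lerNnormlW.
have h01 := h a0 a1; have h02 := h a0 a2; have h12 := h a1 a2.
have s0 := real_normK (num_real a0); have s1 := real_normK (num_real a1).
have s2 := real_normK (num_real a2).
move: s0 s1 s2 h01 h02 h12; set x := `|a0|; set y := `|a1|; set w := `|a2|.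
lra.
Qed.

Lemma tau_mul_le b i j z : i != j ->
  2 * `|tau b i z * tau b j z| <= `|z| ^+ 2 - sqtau b z.
Proof.
move=> ij; apply: le_trans (_ : (\sum_i `|tau b i z|) ^+ 2 - sqtau b z <= _); last first.
  by rewrite lerD2r sqr_sum_norm_tau.
rewrite /sqtau !big_ord_recl !big_ord0 !addr0 normrM.
have sq k := real_normK (num_real (tau b k z)).
have pos k l : 0 <= `|tau b k z| * `|tau b l z| by rewrite mulr_ge0.
have s0 := sq ord0; have s1 := sq (lift ord0 ord0).
have s2 := sq (lift ord0 (lift ord0 ord0)).
have h1 := pos ord0 (lift ord0 ord0).
have h2 := pos ord0 (lift ord0 (lift ord0 ord0)).
have h3 := pos (lift ord0 ord0) (lift ord0 (lift ord0 ord0)).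
by move: ij; elim/ord3_ind: i; elim/ord3_ind: j => // _; lra.
Qed.

(** The right side is the sum of all three squared deviations, because s / 3 is the mean of the
    tau_(b,i). *)
Lemma tau_dev_le b i z : (tau b i z - zs z / 3) ^+ 2 <= sqtau b z - zs z ^+ 2 / 3.
Proof.
have -> : sqtau b z - zs z ^+ 2 / 3 = \sum_i (tau b i z - zs z / 3) ^+ 2.
  have := sum_tau b z; rewrite /sqtau !big_ord_recl !big_ord0 !addr0 => <-; lra.
by rewrite (bigD1 i)//= lerDl sumr_ge0// => j _; rewrite sqr_ge0.
Qed.

Lemma sqtau_ge b z : zs z ^+ 2 / 3 <= sqtau b z.
Proof. by rewrite -subr_ge0 (le_trans _ (tau_dev_le b ord0 z))// sqr_ge0. Qed.

(** The defect of [null_dominated]: forms controlled by it are null at every norm-one g with P(g) =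
    1. *)
Definition gap z : R := `|z| ^+ 2 - `|exP z z|.

(** Here b is the sign of P(z); the estimates below treat this sign and the opposite one
    separately. *)
Lemma exP_sign z : exists b, 0 <= sqtau b z - sqtau (~~ b) z /\
  gap z = `|z| ^+ 2 - 3 / 2 * (sqtau b z - sqtau (~~ b) z).
Proof.
have [h|h] := leP 0 (sqtau true z - sqtau false z).
  exists true; split=> //; rewrite /gap (exP_diag true) mul1r ger0_norm//.
  by rewrite mulr_ge0.
exists false; split; first by rewrite /=; lra.
rewrite /gap (exP_diag false) mulN1r normrN ger0_norm//.
by rewrite mulr_ge0//=; lra.
Qed.

(** Inserting [sqtau_le] for the sign of P(z) and [sqtau_ge] for the other gives gap >= |z|^2 - 3/4
    (|z|^2 + s^2) + s^2 / 2. In particular |P(z)| <= |z|^2. *)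
Lemma zs_gap z : `|z| ^+ 2 - zs z ^+ 2 <= 4 * gap z.
Proof.
have [b [_ ->]] := exP_sign z.
have := sqtau_le b z; have := sqtau_ge (~~ b) z; lra.
Qed.

Lemma gap_ge0 z : 0 <= gap z.
Proof. by have := zs_gap z; have := sqr_zs_le z; lra. Qed.

Lemma gap_le z : gap z <= `|z| ^+ 2.
Proof. by rewrite /gap lerBlDr lerDl. Qed.

Lemma exP_le z : `|exP z z| <= 1 * `|z| ^+ 2.
Proof. by rewrite mul1r -subr_ge0; exact: gap_ge0. Qed.

Lemma tau_le b i z : `|tau b i z| <= `|z|.
Proof.
by apply: le_trans (sum_norm_tau b z); rewrite (bigD1 i)//= lerDl sumr_ge0.
Qed.

Lemma dev_sqr_le b i z : (tau b i z - zs z / 3) ^+ 2 <= `|z| ^+ 2.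
Proof.
have := tau_dev_le b i z; have := sqtau_le b z; have := sqr_zs_le z.
have := sqr_ge0 (zs z); lra.
Qed.

(** One of the two signs is opposite to that of P(z). The squared deviation for it is at most the
    gap, the other one at most |z|^2. *)
Lemma dev_mul_le b i j z :
  ((tau b i z - zs z / 3) * (tau (~~ b) j z - zs z / 3)) ^+ 2 <=
    1 * `|z| ^+ 2 * gap z.
Proof.
rewrite mul1r exprMn.
have [c [c0 gE]] := exP_sign z.
have gc k : (tau (~~ c) k z - zs z / 3) ^+ 2 <= gap z.
  rewrite gE; have := tau_dev_le (~~ c) k z; have := sqtau_le c z.
  have := sqr_zs_le z; have := sqtau_ge (~~ c) z; lra.
have [bc|bc] := eqVneq b c.
  by rewrite bc ler_pM ?sqr_ge0// dev_sqr_le.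
have {}bc : b = ~~ c by case: (b) (c) bc => [] [].
by rewrite mulrC bc ler_pM ?sqr_ge0// dev_sqr_le.
Qed.

(** If the gap is 0, then s^2 = |z|^2 = |P(z)|. For b the sign of P(z), both terms on the left
    vanish; for the opposite sign all tau_(b,i) equal s / 3 and both terms are s^2 / 9. The proof
    makes this quantitative. *)
Lemma pair_gap_le b i j z : i != j ->
  (tau b i z * tau b j z - 18^-1 * (zs z ^+ 2 - sgb b * exP z z)) ^+ 2 <=
    9 * `|z| ^+ 2 * gap z.
Proof.
move=> ij.
have [c [c0 gE]] := exP_sign z.
have E := exP_diag c z.
have g0 := gap_ge0 z; have gM := gap_le z.
have sM := sqr_zs_le z; have sg := zs_gap z.
have M0 : 0 <= `|z| ^+ 2 by rewrite exprn_ge0.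
have p := tau_mul_le b z ij.
have cP : sgb c * exP z z = `|z| ^+ 2 - gap z.
  by rewrite E gE; case: (c); rewrite /sgb; lra.
set M := `|z| ^+ 2 in g0 gM sM sg M0 p cP gE *; set D := gap z in g0 gM sg cP gE *.
have [bc|bc] := eqVneq b c.
  have t : `|tau b i z * tau b j z| <= D.
    move: p; rewrite gE bc; have := sqtau_le c z; have := sqtau_ge (~~ c) z.
    rewrite -/M; lra.
  rewrite bc cP -bc; move: t; set t := _ * _; rewrite ler_norml => /andP[t1 t2].
  set S := zs z ^+ 2 in sM sg *.
  have h : `|t - 18^-1 * (S - (M - D))| <= 2 * D by rewrite ler_norml; lra.
  rewrite -real_normK ?num_real//.
  apply: le_trans (_ : (2 * D) ^+ 2 <= _); first by rewrite lerXn2r ?nnegrE ?mulr_ge0.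
  have := ler_wpM2r g0 gM; have := mulr_ge0 M0 g0; lra.
have nP : sgb b * exP z z = - (M - D).
  by rewrite -cP; move: bc; case: (b); case: (c) => // _; rewrite /sgb; lra.
rewrite nP.
have {}bc : b = ~~ c by move: bc; case: (b); case: (c).
set x := tau b i z - zs z / 3; set y := tau b j z - zs z / 3; set s := zs z.
have xD : x ^+ 2 <= D.
  by rewrite gE /x bc; have := tau_dev_le (~~ c) i z; have := sqtau_le c z;
     rewrite -/M; lra.
have yD : y ^+ 2 <= D.
  by rewrite gE /y bc; have := tau_dev_le (~~ c) j z; have := sqtau_le c z;
     rewrite -/M; lra.
have -> : tau b i z * tau b j z - 18^-1 * (s ^+ 2 - - (M - D)) =
    x * y + s * (x + y) / 3 + (s ^+ 2 - (M - D)) / 18.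
  by rewrite /x /y -/s; field.
(* Each of the three squares is at most M D, and (u + v + w)^2 <= 3 (u^2 + v^2 + w^2); hence the
   factor 9. *)
set u := x * y; set v := s * (x + y) / 3; set w := _ / 18.
have u2 : u ^+ 2 <= M * D.
  by rewrite exprMn; apply: ler_pM; rewrite ?sqr_ge0//; exact: le_trans xD gM.
have v2 : v ^+ 2 <= M * D.
  have xy : (x + y) ^+ 2 <= 4 * D by have := sqr_ge0 (x - y); lra.
  have -> : v ^+ 2 = s ^+ 2 * ((x + y) ^+ 2 / 9) by rewrite /v; field.
  by apply: ler_pM; rewrite ?divr_ge0 ?sqr_ge0//; lra.
have w2 : w ^+ 2 <= M * D.
  have wD : `|w| <= D by rewrite /w -/s ler_norml; move: sM sg; rewrite -/s; lra.
  rewrite -real_normK ?num_real//.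
  apply: le_trans (_ : D ^+ 2 <= _); first by rewrite lerXn2r ?nnegrE.
  exact: ler_wpM2r.
have := sqr_ge0 (u - v); have := sqr_ge0 (u - w); have := sqr_ge0 (v - w).
move: u2 v2 w2; lra.
Qed.

End example_form.

(** * The elements A_(b,j) and a decomposition of Z *)

Section example_elements.
Variable R : realType.

Definition exZ_fun (c : bool -> 'I_3 -> R) (r : nat -> R) (x : ex_index) : R^o :=
  match x with
  | inl (b, i) => c b i
  | inr (false, n) => r n
  | inr (true, n) => 2 * r n - r n.+1
  end.

Lemma exZ_fun_subproof c r : (forall b, \sum_i c b i = r 0%N) -> r @ \oo --> (0 : R) ->
  exZ_fun c r \in fs_pred (Zspace R).
Proof. by move=> cr r0; apply/asboolP. Qed.

Definition exZ_build c r (cr : forall b, \sum_i c b i = r 0%N)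
    (r0 : r @ \oo --> (0 : R)) : exZ R :=
  @FunElt _ _ (Zspace R) _ (exZ_fun_subproof cr r0).

Lemma exZ_norm_le (z : exZ R) K : 0 <= K -> (forall b i, `|zu b i z| <= K) ->
  (forall n, `|zr n z| <= K) -> (forall n, `|2 * zr n z - zr n.+1 z| <= K) ->
  `|z| <= K.
Proof.
move=> K0 uK rK yK; rewrite fun_normE; apply: fun_norm_le => // -[[b i]|[[] n]] //.
- exact: uK.
- by have [_ -> _] := exZP z.
- exact: rK.
Qed.

Lemma exZ_eq (z w : exZ R) : (forall b i, zu b i z = zu b i w) ->
  (forall n, zr n z = zr n w) -> z = w.
Proof.
move=> u r; apply/val_inj/funext => -[[b i]|[[] n]]; first exact: u.
  have [_ yz _] := exZP z; have [_ yw _] := exZP w.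
  by rewrite [LHS]yz [RHS]yw !r.
exact: r.
Qed.

(** Since u = s - 2 tau, these coordinates with s = 0 mean that tau_(b,i) is delta_ij - 1/3 at
    A_(b,j), and that the tau of the other sign vanish. *)
Definition exA_u (b : bool) (j : 'I_3) (c : bool) (i : 'I_3) : R :=
  if c == b then 2 / 3 - 2 * (i == j)%:R else 0.

Lemma sum_delta (j : 'I_3) : \sum_(i < 3) ((i == j)%:R : R) = 1.
Proof. by rewrite (bigD1 j)//= eqxx big1 ?addr0// => i /negbTE ->. Qed.

Lemma exA_subproof b j c : \sum_i exA_u b j c i = (fun=> 0) 0%N.
Proof.
rewrite /exA_u; case: eqP => _; last by rewrite big1.
rewrite sumrB -[X in _ - X]mulr_sumr sum_delta sumr_const card_ord; lra.
Qed.

Definition exA b j : exZ R := exZ_build (exA_subproof b j) (cvg_cst (0 : R)).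

Lemma zu_exA b j c i : zu c i (exA b j) = exA_u b j c i. Proof. by []. Qed.
Lemma zr_exA b j n : zr n (exA b j) = 0. Proof. by []. Qed.

Lemma tau_exA b j c i : tau c i (exA b j) = if c == b then (i == j)%:R - 3^-1 else 0.
Proof. by rewrite /tau zu_exA /zs -/(zr 0 _) zr_exA /exA_u; case: eqP => _; lra. Qed.

Lemma sum_exA b : \sum_j exA b j = 0.
Proof.
apply: exZ_eq => [c i|n].
  transitivity (\sum_j zu c i (exA b j)).
    exact: (big_morph (zu c i : exZ R -> R^o)).
  transitivity (0 : R) => //; under eq_bigr do rewrite zu_exA.
  rewrite /exA_u; case: eqP => _; last by rewrite big1.
  have D : \sum_j ((i == j)%:R : R) = 1.
    by rewrite -[RHS](sum_delta i); apply: eq_bigr => j _; rewrite eq_sym.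
  rewrite sumrB -[X in _ - X]mulr_sumr D sumr_const card_ord; lra.
transitivity (\sum_j zr n (exA b j)); first exact: (big_morph (zr n : exZ R -> R^o)).
by rewrite big1.
Qed.

(** The element [exH n] has r_k = delta_kn. Only for n = 0 is s nonzero; then all u_(b,i) are s / 3,
    and so are all tau_(b,i). *)
Definition exH_u (n : nat) (b : bool) (i : 'I_3) : R := (n == 0)%:R / 3.
Definition exH_r (n k : nat) : R := (k == n)%:R.

Lemma exH_subproof n b : \sum_i exH_u n b i = exH_r n 0.
Proof. by rewrite sumr_const card_ord /exH_r eq_sym; lra. Qed.

Lemma exH_cvg n : exH_r n @ \oo --> (0 : R).
Proof.
apply: cvg_near_cst; exists n.+1 => // k /= nk.
by rewrite /exH_r gtn_eqF.
Qed.

Definition exH n : exZ R := exZ_build (exH_subproof n) (exH_cvg n).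

(** The projection onto the finite-dimensional span of the A_(b,j). The rest z - proj0 z is the sum
    of the series r_n [exH n], whose partial sums are the [proj_r m]. *)
Definition proj0 (z : exZ R) : exZ R := \sum_b \sum_j tau b j z *: exA b j.
Definition proj_r m (z : exZ R) : exZ R := \sum_(n < m) zr n z *: exH n.

Lemma proj0_linear : linear proj0.
Proof.
move=> a x y; rewrite /proj0 scaler_sumr -big_split /=; apply: eq_bigr => b _.
rewrite scaler_sumr -big_split /=; apply: eq_bigr => j _.
by rewrite tau_linear scalerDl scale_regE scalerA.
Qed.

Lemma proj_r_linear m : linear (proj_r m).
Proof.
move=> a x y; rewrite /proj_r scaler_sumr -big_split /=; apply: eq_bigr => n _.
by rewrite zr_linear scalerDl scale_regE scalerA.
Qed.

Lemma zu_proj0 b i z : zu b i (proj0 z) = zu b i z - zs z / 3.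
Proof.
transitivity (\sum_c \sum_j tau c j z * zu b i (exA c j)).
  rewrite /proj0 (big_morph (zu b i : exZ R -> R^o) (id1 := 0) (op1 := +%R))//.
  apply: eq_bigr => c _.
  by rewrite (big_morph (zu b i : exZ R -> R^o) (id1 := 0) (op1 := +%R)).
rewrite (bigD1 b)//= [X in _ + X]big1 ?addr0; last first.
  by move=> c cb; apply: big1 => j _; rewrite zu_exA /exA_u eq_sym (negbTE cb) mulr0.
have -> : \sum_j tau b j z * zu b i (exA b j) =
    2 / 3 * \sum_j tau b j z - 2 * \sum_j tau b j z * (i == j)%:R.
  rewrite !mulr_sumr -sumrB; apply: eq_bigr => j _.
  by rewrite zu_exA /exA_u eqxx; ring.
rewrite sum_tau.
rewrite (bigD1 i)//= eqxx mulr1 big1 ?addr0; last first.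
  by move=> j ji; rewrite eq_sym (negbTE ji) mulr0.
by rewrite /tau mulrA mulfV//; lra.
Qed.

Lemma zr_proj0 n z : zr n (proj0 z) = 0.
Proof.
rewrite /proj0 (big_morph (zr n : exZ R -> R^o) (id1 := 0) (op1 := +%R))//.
rewrite big1// => c _.
rewrite (big_morph (zr n : exZ R -> R^o) (id1 := 0) (op1 := +%R))//.
by rewrite big1// => j _; rewrite [LHS]mulr0.
Qed.

(** The index [m.+1] guarantees the term n = 0, the only one with nonzero u coordinates. *)
Lemma zu_proj_r m b i z : zu b i (proj_r m.+1 z) = zs z / 3.
Proof.
rewrite /proj_r (big_morph (zu b i : exZ R -> R^o) (id1 := 0) (op1 := +%R))//.
rewrite big_ord_recl big1 ?addr0 => [|j _].
  by transitivity (zs z * (1 / 3)) => //; lra.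
by transitivity (zr (lift ord0 j) z * (0 / 3)) => //; lra.
Qed.

Lemma zr_proj_r m n z : zr n (proj_r m z) = if (n < m)%N then zr n z else 0.
Proof.
rewrite /proj_r (big_morph (zr n : exZ R -> R^o) (id1 := 0) (op1 := +%R))//.
case: ltnP => nm.
  rewrite (bigD1 (Ordinal nm))//= big1 ?addr0 => [|j jn].
    by transitivity (zr n z * (n == n)%:R) => //; rewrite eqxx mulr1.
  transitivity (zr j z * (n == j)%:R) => //; rewrite eq_sym.
  by move: jn; rewrite -val_eqE /= => /negbTE ->; rewrite mulr0.
rewrite big1// => j _; transitivity (zr j z * (n == j)%:R) => //.
by rewrite gtn_eqF ?mulr0// (leq_trans _ nm).
Qed.

Lemma zuB b i (x y : exZ R) : zu b i (x - y) = zu b i x - zu b i y. Proof. by []. Qed.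
Lemma zrB n (x y : exZ R) : zr n (x - y) = zr n x - zr n y. Proof. by []. Qed.

Lemma proj0_norm z : `|proj0 z| <= 2 * `|z|.
Proof.
have z0 : 0 <= 2 * `|z| by rewrite mulr_ge0.
apply: exZ_norm_le => [//|b i|n|n].
- rewrite zu_proj0.
  have : `|zs z| <= `|z| by exact: zr_le.
  have : `|zu b i z| <= `|z| by exact: le_coord.
  rewrite !ler_norml => /andP[? ?] /andP[? ?]; apply/andP; split; lra.
- by rewrite zr_proj0 normr0.
- by rewrite !zr_proj0 mulr0 subr0 normr0.
Qed.

(** In the remainder the u_(b,i) and the r_n with n <= m vanish. The factor 3 comes from y_n = 2 r_n
    - r_(n+1). *)
Lemma proj_r_dist m (z : exZ R) e : 0 <= e -> (forall n, (m < n)%N -> `|zr n z| <= e) ->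
  `|z - proj0 z - proj_r m.+1 z| <= 3 * e.
Proof.
move=> e0 ze; have e3 : 0 <= 3 * e by rewrite mulr_ge0.
have tl n : `|zr n (z - proj0 z - proj_r m.+1 z)| <= e.
  rewrite !zrB zr_proj0 zr_proj_r subr0; case: ltnP => nm; first by rewrite subrr normr0.
  by rewrite subr0 ze.
apply: exZ_norm_le => [//|b i|n|n].
- rewrite !zuB zu_proj0 zu_proj_r.
  by rewrite (_ : _ - _ = 0) ?normr0//; lra.
- by rewrite (le_trans (tl n))//; lra.
- have := tl n; have := tl n.+1.
  by rewrite !ler_norml => /andP[? ?] /andP[? ?]; apply/andP; split; lra.
Qed.

Lemma proj_r_bound m (z : exZ R) : `|z - proj0 z - proj_r m.+1 z| <= 3 * `|z|.
Proof. by apply: proj_r_dist => // n _; exact: zr_le. Qed.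

Lemma proj_r_cvg (z : exZ R) : (fun m => proj_r m.+1 z) @ \oo --> z - proj0 z.
Proof.
apply/cvgrPdist_le => e e0; have e3 : 0 < e / 3 by rewrite divr_gt0.
have [_ _ /cvgrPdist_le /(_ _ e3) [N _ zN]] := exZP z.
exists N => // m /= Nm; apply: le_trans (_ : 3 * (e / 3) <= _); last by lra.
apply: proj_r_dist => [|n mn]; first exact: ltW.
have /= := zN n; rewrite sub0r normrN; apply.
exact: leq_trans Nm (ltnW mn).
Qed.

End example_elements.

(** * Uniqueness of the norm-one tensor with P(g) = 1 *)

Section example_unique.
Variable R : realType.
Let Z := exZ R.
Let p := @sym_proj_norm R 2 Z.

Lemma exP_dual u : `|quad_eval (exP_bilin R) u| <= p u.
Proof. by rewrite -[leRHS]mul1r; apply: linear_bound => // z; exact: exP_le. Qed.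

Definition exP_functional : dual_ball p :=
  exist _ (quad_eval (exP_bilin R) : {linear _ -> _}) exP_dual.

(** For a sign c, the relations r_(m+1) = 2 r_m - y_m and |y_m| <= |z| show that |z| - c r_m at most
    doubles from m to m + 1. So r_n is close to s when |s| is close to |z|, which a small gap forces
    by [zs_gap]. *)
Lemma zr_dist_sqr n (z : Z) : (zs z - zr n z) ^+ 2 <= 8 * 2 ^+ n * gap z.
Proof.
have M0 : 0 <= `|z| by [].
have [_ yz _] := exZP z.
have ind (s : R) : s = 1 \/ s = -1 -> forall m,
    `|z| - s * zr m z <= 2 ^+ m * (`|z| - s * zs z).
  move=> s1; elim=> [|m ih]; first by rewrite expr0 mul1r.
  have := le_coord z (inr (true, m)); rewrite yz => y1.
  rewrite exprS -mulrA; apply: le_trans (_ : 2 * (`|z| - s * zr m z) <= _).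
    move: y1; rewrite ler_norml => /andP[? ?].
    by case: s1 => ->; lra.
  by rewrite ler_pM2l.
have rM := zr_le n z; have sM : `|zs z| <= `|z| := zr_le 0 z.
have e1 : (1 : R) <= 2 ^+ n by rewrite exprn_ege1// ler1n.
have dist : `|zs z - zr n z| <= 2 ^+ n * (`|z| - `|zs z|).
  have D0 : 0 <= `|z| - `|zs z| by rewrite subr_ge0.
  have D1 : `|z| - `|zs z| <= 2 ^+ n * (`|z| - `|zs z|) by rewrite ler_peMl.
  have [sl sr] : - `|z| <= zs z /\ zs z <= `|z| by apply/andP; rewrite -ler_norml.
  move: rM D1; rewrite !ler_norml => /andP[r1 r2].
  have [s0|s0] := ger0P (zs z); move=> D1.
    by have := ind 1 (or_introl erefl) n; rewrite !mul1r; lra.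
  by have := ind (-1) (or_intror erefl) n; rewrite !mulN1r !opprK; lra.
(* One factor of the square is bounded by this, the other by [dist]; then |z| (|z| - |s|) <= |z|^2 -
   s^2. *)
have dist2 : `|zs z - zr n z| <= 2 * `|z|.
  by rewrite (le_trans (ler_normB _ _))// mulr_natl mulr2n lerD.
rewrite -real_normK ?num_real// expr2.
apply: le_trans (ler_pM _ _ dist2 dist) _ => //.
apply: le_trans (_ : 2 * 2 ^+ n * (`|z| ^+ 2 - zs z ^+ 2) <= _).
  rewrite (_ : 2 * `|z| * (2 ^+ n * _) = 2 * 2 ^+ n * (`|z| * (`|z| - `|zs z|))); last by ring.
  rewrite ler_wpM2l ?mulr_ge0 ?exprn_ge0//.
  rewrite -[zs z ^+ 2]real_normK ?num_real//.
  have := ler_wpM2r (normr_ge0 (zs z)) sM; lra.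
rewrite (_ : 8 * 2 ^+ n * _ = 2 * 2 ^+ n * (4 * gap z)); last by ring.
by rewrite ler_wpM2l ?mulr_ge0 ?exprn_ge0// zs_gap.
Qed.

Section norming.
Variable g : fun_elt (completion_space p).
Hypotheses (g1 : `|g| <= 1) (gP : g exP_functional = 1).

Let null_gap q C : 0 <= C -> (forall z, q z ^+ 2 <= C * `|z| ^+ 2 * gap z) ->
  null g q.
Proof. exact: null_dominated gP _ _. Qed.

(** Each (s - r_m) l is null by [zr_dist_sqr]. As r_m tends to 0 pointwise on Z, these forms
    converge to s l, and [null_lim] applies. *)
Lemma null_zs (l : Z -> R) K : linear (l : Z -> R^o) -> 0 <= K ->
  (forall z, `|l z| <= K * `|z|) -> null g (fun z => zs z * l z).
Proof.
move=> ll K0 lK.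
have lK2 z : l z ^+ 2 <= K ^+ 2 * `|z| ^+ 2.
  by rewrite -exprMn -real_normK ?num_real// lerXn2r ?nnegrE ?mulr_ge0.
have bb := bilin_mul (zr_linear 0) ll.
have bb_ m := bilin_mul (zr_linear m) ll.
apply: (null_lim g1 bb (fun m => bilinB bb (bb_ m)) (K := K)).
- move=> m z; rewrite opprB addrCA subrr addr0 normrM.
  rewrite expr2 mulrA mulrC; apply: ler_pM => //; exact: zr_le.
- move=> z; rewrite -[X in _ --> X]subr0; apply: cvgB; first exact: cvg_cst.
  have [_ _ zr0] := exZP z.
  by rewrite -(mul0r (l z)); apply: cvgM => //; exact: cvg_cst.
- move=> m; apply: (@null_gap _ (8 * 2 ^+ m * K ^+ 2)) => [|z].
    by rewrite !mulr_ge0 ?exprn_ge0.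
  rewrite -mulrBl exprMn.
  rewrite [leRHS](_ : _ = (8 * 2 ^+ m * gap z) * (K ^+ 2 * `|z| ^+ 2)); last by ring.
  by apply: ler_pM; rewrite ?sqr_ge0//; exact: zr_dist_sqr.
Qed.

Lemma null_zr n (l : Z -> R) K : linear (l : Z -> R^o) -> 0 <= K ->
  (forall z, `|l z| <= K * `|z|) -> null g (fun z => zr n z * l z).
Proof.
move=> ll K0 lK.
have lK2 z : l z ^+ 2 <= K ^+ 2 * `|z| ^+ 2.
  by rewrite -exprMn -real_normK ?num_real// lerXn2r ?nnegrE ?mulr_ge0.
have nd : null g (fun z => (zs z - zr n z) * l z).
  apply: (@null_gap _ (8 * 2 ^+ n * K ^+ 2)) => [|z].
    by rewrite !mulr_ge0 ?exprn_ge0.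
  rewrite exprMn.
  rewrite [leRHS](_ : _ = (8 * 2 ^+ n * gap z) * (K ^+ 2 * `|z| ^+ 2)); last by ring.
  by apply: ler_pM; rewrite ?sqr_ge0//; exact: zr_dist_sqr.
apply: null_ext (nullD (null_zs ll K0 lK) (nullZ (-1) nd)) => z; ring.
Qed.

(** The value of tau_(b,i) tau_(c,j) at v, because sum_k (delta_ik - 1/3) (delta_jk - 1/3) =
    delta_ij - 1/3. *)
Definition tau_coef (b : bool) (i : 'I_3) (c : bool) (j : 'I_3) : R :=
  if b == c then sgb b * ((i == j)%:R / 6 - 18^-1) else 0.

Let null_zs_tau b i : null g (fun z => zs z * tau b i z).
Proof.
by apply: (null_zs (tau_linear b i) ler01) => z; rewrite mul1r tau_le.
Qed.

Let null_zs2 : null g (fun z => zs z * zs z).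
Proof. by apply: (null_zs (zr_linear 0) ler01) => z; rewrite mul1r zr_le. Qed.

Lemma null_tau_neq b i j : i != j ->
  null g (fun z => tau b i z * tau b j z + sgb b / 18 * exP z z).
Proof.
move=> ij.
have n1 : null g (fun z => tau b i z * tau b j z
    - 18^-1 * (zs z ^+ 2 - sgb b * exP z z)).
  by apply: (@null_gap _ 9) => // z; exact: pair_gap_le.
by apply: null_ext (nullD n1 (nullZ 18^-1 null_zs2)) => z /=; field.
Qed.

(** For opposite signs, the product differs from that of the deviations by terms containing s. For
    equal signs and i = j, tau_i^2 is s tau_i minus the products with the other two tau_k, which
    reduces to distinct indices. *)
Lemma null_tau b i c j :
  null g (fun z => tau b i z * tau c j z - tau_coef b i c j * exP z z).
Proof.
rewrite /tau_coef; have [<-{c}|bc] := eqVneq b c; last first.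
  have -> : c = ~~ b by move: bc; case: b; case: c.
  have n1 : null g (fun z => (tau b i z - zs z / 3) * (tau (~~ b) j z - zs z / 3)).
    by apply: (@null_gap _ 1) => // z; exact: dev_mul_le.
  have n2 := nullD n1 (nullZ 3^-1 (nullD (null_zs_tau b i) (null_zs_tau (~~ b) j))).
  apply: null_ext (nullD n2 (nullZ (- 9^-1) null_zs2)) => z /=.
  by field.
have [<-{j}|ij] := eqVneq i j; last first.
  by apply: null_ext (null_tau_neq b ij) => z /=; field.
have n1 : null g (fun z => \sum_(k < 3) (if i == k then 0 else
    tau b i z * tau b k z + sgb b / 18 * exP z z)).
  apply: null_sum => k; have [_|ik] := eqVneq i k; first exact: null0.
  exact: null_tau_neq.
apply: null_ext (nullD (null_zs_tau b i) (nullZ (-1) n1)) => z /=.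
rewrite -(sum_tau b z).
move: (exP z z) => P; elim/ord3_ind: i {n1};
  rewrite !big_ord_recl !big_ord0 /=; lra.
Qed.

Section functional.
Variable F : dual_ball p.
Let beta := polar (sval F).
Let bb : bilin beta := polar_bilin (sval F).

Let beta_diag (z : Z) : beta z z = sval F (tensor_pow 2 z).
Proof. exact: polar_diag. Qed.

Let beta_le (x y : Z) : `|beta x y| <= 2 * `|x| * `|y|.
Proof.
rewrite -[2]mulr1; apply: bilin_bound => // [s t|z]; first exact: polarC.
rewrite beta_diag mul1r (le_trans (svalP F _))//; exact: sym_proj_norm_pow.
Qed.

Let wsum (z : Z) := z + proj0 z.
Let wsum_linear : linear wsum.
Proof. by move=> a x y; rewrite /wsum proj0_linear scalerDr addrACA. Qed.
Let wsum_le z : `|wsum z| <= 3 * `|z|.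
Proof.
rewrite (le_trans (ler_normD _ _))//; have := proj0_norm z; lra.
Qed.

(** By symmetry of beta this form is beta(z,z) - beta(proj0 z, proj0 z). With [proj_r] in place of z
    - proj0 z it becomes a finite sum of r_n times bounded functionals, null by [null_zr]; then
    [null_lim] applies. *)
Lemma null_tail : null g (fun z => beta (z - proj0 z) (z + proj0 z)).
Proof.
have bl (f : Z -> Z) : linear f -> bilin (fun x y => beta (f x) (wsum y)).
  move=> fl; split=> [y a u v|x a u v].
    by rewrite fl (bilinDl _ _ _ bb) (bilinZl _ _ _ bb).
  by rewrite wsum_linear (bilinDr _ _ _ bb) (bilinZr _ _ _ bb).
have lin1 : linear (fun z : Z => z - proj0 z).
  by move=> a x y; rewrite proj0_linear scalerBr opprD addrACA.
(* 18 = 2 * 3 * 3, from [beta_le], [proj_r_bound] and [wsum_le]. *)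
apply: (null_lim g1 (bl _ lin1) (fun m => bl _ (proj_r_linear m.+1)) (K := 18)).
- move=> m z; rewrite -(bilinNl _ _ bb) -(bilinDl _ _ _ bb).
  apply: le_trans (beta_le _ _) _.
  rewrite (_ : 18 * _ = 2 * (3 * `|z|) * (3 * `|z|)); last by ring.
  apply: ler_pM => //; first by rewrite ler_pM2l// proj_r_bound.
- move=> z; apply/cvgrPdist_le => e e0.
  have K0 : 0 < 1 + 2 * `|wsum z| by rewrite ltr_pwDl// mulr_ge0.
  have /cvgrPdist_le /(_ _ (divr_gt0 e0 K0)) := @proj_r_cvg R z.
  apply: filterS => m h; rewrite -(bilinNl _ _ bb) -(bilinDl _ _ _ bb).
  apply: le_trans (beta_le _ _) _.
  rewrite mulrAC; apply: le_trans (ler_wpM2l _ h) _; first by rewrite mulr_ge0.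
  by rewrite mulrCA ler_piMr ?(ltW e0)// ler_pdivrMr// mul1r lerDr.
- move=> m.
  apply: (@null_ext _ _ g (fun z => \sum_(n < m.+1) zr n z * beta (exH R n) (wsum z))).
    move=> z; rewrite /proj_r (bilin_suml _ _ _ _ bb); apply: eq_bigr => n _.
    by rewrite (bilinZl _ _ _ bb).
  apply: null_sum => n.
  apply: (null_zr n (K := 6 * `|exH R n|)) => [a x y||z].
  + by rewrite wsum_linear (bilinDr _ _ _ bb) (bilinZr _ _ _ bb).
  + by rewrite mulr_ge0.
  + apply: le_trans (beta_le _ _) _.
    rewrite (_ : 6 * _ * _ = 2 * `|exH R n| * (3 * `|z|)); last by ring.
    by rewrite ler_wpM2l ?mulr_ge0// wsum_le.
Qed.

(** It depends on F alone and not on g, whence the uniqueness. *)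
Definition norming_value : R := \sum_b \sum_i \sum_c \sum_j
  tau_coef b i c j * beta (exA R b i) (exA R c j).

(** After removal of [null_tail] there remains beta(proj0 z, proj0 z), a combination of the products
    in [null_tau]. *)
Lemma null_functional :
  null g (fun z => sval F (tensor_pow 2 z) - norming_value * exP z z).
Proof.
have n0 : null g (fun z => \sum_b \sum_i \sum_c \sum_j beta (exA R b i) (exA R c j) *
    (tau b i z * tau c j z - tau_coef b i c j * exP z z)).
  do 4 apply: null_sum => ?; exact/nullZ/null_tau.
apply: null_ext (nullD null_tail n0) => z.
have -> : sval F (tensor_pow 2 z) =
    beta (z - proj0 z) (z + proj0 z) + beta (proj0 z) (proj0 z).
  rewrite -beta_diag !(bilinDl _ _ _ bb, bilinDr _ _ _ bb) !(bilinNl _ _ bb).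
  have -> : beta (proj0 z) z = beta z (proj0 z) by exact: polarC.
  ring.
rewrite -addrA; congr (_ + _).
have -> : beta (proj0 z) (proj0 z) = \sum_b \sum_i \sum_c \sum_j
    tau b i z * tau c j z * beta (exA R b i) (exA R c j).
  rewrite [X in beta X _]/proj0 (bilin_suml _ _ _ _ bb); apply: eq_bigr => b _.
  rewrite (bilin_suml _ _ _ _ bb); apply: eq_bigr => i _.
  rewrite (bilinZl _ _ _ bb) [X in beta _ X]/proj0 (bilin_sumr _ _ _ _ bb).
  rewrite mulr_sumr; apply: eq_bigr => c _.
  rewrite (bilin_sumr _ _ _ _ bb) mulr_sumr; apply: eq_bigr => j _.
  by rewrite (bilinZr _ _ _ bb) mulrA.
rewrite /norming_value mulr_suml -sumrB; apply: eq_bigr => b _.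
rewrite mulr_suml -sumrB; apply: eq_bigr => i _.
rewrite mulr_suml -sumrB; apply: eq_bigr => c _.
rewrite mulr_suml -sumrB; apply: eq_bigr => j _.
ring.
Qed.


Lemma norming_unique : g F = norming_value.
Proof.
apply/eqP; rewrite -subr_eq0 -normr_le0; apply/ler_addgt0Pr => e e0.
have K0 : 0 < 2 + `|norming_value| by rewrite ltr_pwDl.
have e3 : 0 < e / 2 by rewrite divr_gt0.
have [d d0 nd] := null_functional e3.
pose d' := Num.min d (e / 2 / (2 + `|norming_value|)).
have d'0 : 0 < d' by rewrite lt_min d0 divr_gt0.
have [n [l [x nlx]]] := near_rep_ex g1 d'0.
have {}nd : `|qsum l x (fun z => sval F (tensor_pow 2 z) - norming_value * exP z z)| <= e / 2.
  by apply: nd; apply: near_rep_le nlx; rewrite ge_min lexx.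
have [_ gF] := nlx.
have hF := gF F; have hP := gF exP_functional.
have E : qsum l x (fun z => sval F (tensor_pow 2 z) - norming_value * exP z z) =
    sval F (sym_rep 2 l x) - norming_value * quad_eval (exP_bilin R) (sym_rep 2 l x).
  rewrite !linear_sym_rep /qsum mulr_sumr -sumrB; apply: eq_bigr => j _.
  by rewrite mulrBr; congr (_ - _); exact: mulrCA.
move: nd hP; rewrite E gP /=; set k := norming_value; set a := sval F _.
set q := quad_eval _ _ => nd hP.
(* The three terms are at most d', e / 2 and |k| d' in modulus. *)
have -> : g F - k = (g F - a) + (a - k * q) - k * (1 - q) by ring.
rewrite add0r; apply: le_trans (ler_normB _ _) _; rewrite normrM.
have kd : `|k| * `|1 - q| <= `|k| * d' by rewrite ler_wpM2l.
have := ler_normD (g F - a) (a - k * q).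
have d'e : (2 + `|k|) * d' <= e / 2.
  by rewrite mulrC -ler_pdivlMr// ge_min lexx orbT.
by move: hF nd kd d'e (ltW d'0); rewrite -/a; lra.
Qed.

End functional.
End norming.
End example_unique.

(** Evaluation at P is the exposing functional: the supremum norm bounds it by 1 on the ball, with
    value 1 only at x. *)
Lemma exposed_point_dual (R : realType) (V : lmodType R) (p : V -> R)
    (x : fun_elt (completion_space p)) (P : dual_ball p) :
  `|x| <= 1 -> x P = 1 ->
  (forall y : fun_elt (completion_space p), `|y| <= 1 -> y P = 1 -> y = x) ->
  exposed_point (@closed_unit_ball R (fun_elt (completion_space p))) x.
Proof.
move=> x1 xP xuniq; split=> //.
pose f (y : fun_elt (completion_space p)) : R := y P.
have fl : linear (f : _ -> R^o) by [].
pose fL := GRing.isLinear.Build R (fun_elt (completion_space p)) R *%R f fl.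
pose G : {scalar fun_elt (completion_space p)} := HB.pack f fL.
exists G; split=> [y|y y1 yx].
  move=> A /nbhs_ballP[e e0 eA]; apply/nbhs_ballP; exists e => // w.
  rewrite -ball_normE /= => yw; apply: eA; rewrite -ball_normE /=.
  exact: le_lt_trans (le_fun_norm (y - w) P) yw.
rewrite [ltRHS]xP lt_neqAle; apply/andP; split.
  by apply/eqP => yP; apply: yx; exact: xuniq.
by rewrite (le_trans (ler_norm _))// (le_trans (le_fun_norm y P)).
Qed.

(** * The exposed point v *)

Section example_point.
Variable R : realType.
Let Z := exZ R.
Let p := @sym_proj_norm R 2 Z.

Definition exV : sym_tensor 2 Z :=
  \sum_b \sum_j (sgb b / 6) *: tensor_pow 2 (exA R b j).

Lemma linear_exV (F : {linear sym_tensor 2 Z -> R^o}) :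
  F exV = \sum_b \sum_j sgb b / 6 * F (tensor_pow 2 (exA R b j)).
Proof.
rewrite linear_sum; apply: eq_bigr => b _; rewrite linear_sum.
by apply: eq_bigr => j _; rewrite linearZ.
Qed.

Lemma quad_eval_exV (f : Z -> Z -> R) (fb : bilin f) :
  quad_eval fb exV = \sum_b \sum_j sgb b / 6 * f (exA R b j) (exA R b j).
Proof. exact: linear_exV. Qed.

Lemma exP_exV : quad_eval (exP_bilin R) exV = 1.
Proof.
rewrite quad_eval_exV /exP; under eq_bigr => b _ do under eq_bigr => j _ do
  under eq_bigr => i _ do rewrite !tau_exA.
rewrite big_bool /= /sgb !big_ord_recl !big_ord0 /=; lra.
Qed.

Lemma geometric_exZ_subproof (q : R) b :
  \sum_i (fun (_ : bool) (_ : 'I_3) => 3^-1) b i = (fun n => q ^+ n) 0%N.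
Proof. by rewrite sumr_const card_ord expr0; lra. Qed.

(** As q tends to 1, these elements of Z approximate coordinatewise the point psi of the bidual,
    which has u_(b,i) = 1/3 and r_n = 1. *)
Definition exPsi (q : R) (q1 : `|q| < 1) : Z :=
  exZ_build (geometric_exZ_subproof q) (cvg_expr q1).

(* The [exA R b j] add up to zero for each [b], and the two signs cancel the
   square of [w]. *)
Lemma exV_shift (w : Z) :
  exV = \sum_b \sum_j (sgb b / 6) *: tensor_pow 2 (exA R b j + w).
Proof.
have E b j : tensor_pow 2 (exA R b j + w) =
    tensor_pow 2 (exA R b j) + (tensor_pow 2 w + tensor_sym (exA R b j) w).
  by rewrite /tensor_sym [X in _ = _ + X]addrC subrK [RHS]addrC subrK.
have S b : \sum_j tensor_sym (exA R b j) w = 0.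
  by rewrite tensor_sym_suml sum_exA tensor_sym0l.
have E2 b : \sum_j (sgb b / 6) *: tensor_pow 2 (exA R b j + w) =
    \sum_j (sgb b / 6) *: tensor_pow 2 (exA R b j) +
    (sgb b / 6) *: (tensor_pow 2 w *+ 3).
  under eq_bigr => j _ do rewrite E scalerDr.
  rewrite big_split /=; congr (_ + _).
  by rewrite -scaler_sumr big_split /= S addr0 sumr_const card_ord.
under [RHS]eq_bigr => b _ do rewrite E2.
rewrite big_split /= -[LHS]addr0; congr (_ + _).
by rewrite big_bool /= -scalerDl /sgb -mulrDl subrr mul0r scale0r.
Qed.

(** The u coordinates are 1, -1 or 1/3 and r_n = q^n; only y_n = (2 - q) q^n can exceed 1. *)
Lemma exA_exPsi_norm (q : R) (q1 : `|q| < 1) b j : 0 <= q ->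
  `|exA R b j + exPsi q1| <= 2 - q.
Proof.
move=> q0; have q2 : q <= 1 by rewrite (le_trans (ler_norm q))// ltW.
have uD c i : zu c i (exA R b j + exPsi q1) = exA_u R b j c i + 3^-1 by [].
have rD n : zr n (exA R b j + exPsi q1) = q ^+ n.
  by transitivity (0 + q ^+ n) => //; rewrite add0r.
have qn n : 0 <= q ^+ n <= 1 by rewrite exprn_ge0//= exprn_ile1.
apply: exZ_norm_le => [|c i|n|n].
- by lra.
- rewrite uD /exA_u; case: (c == b); case: (i == j) => /=;
    rewrite ler_norml; apply/andP; split; lra.
- by rewrite rD ler_norml; have /andP[? ?] := qn n; apply/andP; split; lra.
- rewrite !rD exprS (_ : 2 * _ - _ = (2 - q) * q ^+ n); last by ring.
  have /andP[n0 n1] := qn n.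
  by rewrite ger0_norm ?mulr_ge0//; [rewrite ler_piMr//; lra | lra].
Qed.

(** A shift by [exPsi] with q = 1 - d leaves six squares of elements of norm at most 1 + d, each
    with weight 1/6; and (1 + d)^2 <= 1 + 3 d. *)
Lemma exV_norm : p exV <= 1.
Proof.
apply/ler_addgt0Pr => e e0.
pose d := Num.min 1 (e / 3).
have d0 : 0 < d by rewrite lt_min ltr01 divr_gt0.
have d1 : d <= 1 by rewrite ge_min lexx.
have de : d <= e / 3 by rewrite ge_min lexx orbT.
have q1 : `|1 - d| < 1 by rewrite ger0_norm; lra.
rewrite (exV_shift (exPsi q1)).
apply: le_trans (sym_proj_norm_sum _ _) _.
apply: (@le_trans _ _ (\sum_(b : bool) \sum_(j < 3) (1 + d) ^+ 2 / 6)).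
  apply: ler_sum => b _; apply: le_trans (sym_proj_norm_sum _ _) _.
  apply: ler_sum => j _; rewrite /p sym_proj_normZ.
  have -> : `|sgb b / 6| = 6^-1 :> R.
    by case: b; rewrite /sgb ?mulN1r ?normrN ?mul1r ger0_norm.
  rewrite mulrC ler_wpM2r//; apply: le_trans (sym_proj_norm_pow 2 _) _.
  have h : `|exA R b j + exPsi q1| <= 1 + d.
    by apply: le_trans (exA_exPsi_norm q1 b j _) _; lra.
  by rewrite lerXn2r ?nnegrE//; lra.
have dd : d * d <= d by rewrite ler_piMl// ltW.
rewrite big_bool /= !sumr_const !card_ord expr2; lra.
Qed.

(** Nonnegative on every square, while its value at v has the sign b: b = false excludes w (x) w and
    b = true excludes its negative. *)
Definition diff_form (b : bool) (x y : Z) : R :=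
  (tau b ord0 x - tau b (lift ord0 ord0) x) * (tau b ord0 y - tau b (lift ord0 ord0) y).

Lemma diff_form_bilin b : bilin (diff_form b).
Proof.
have lin : linear ((fun x => tau b ord0 x - tau b (lift ord0 ord0) x) : Z -> R^o).
  by move=> a x y; rewrite !tau_linear scalerBr opprD addrACA.
exact: (bilin_mul lin lin).
Qed.

Lemma diff_form_dual b u : `|quad_eval (diff_form_bilin b) u| <= p u.
Proof.
rewrite -[leRHS]mul1r; apply: linear_bound => // z.
rewrite mul1r [X in `|X|](_ : _ = diff_form b z z)// /diff_form -expr2 ger0_norm ?sqr_ge0//.
rewrite -[leLHS]real_normK ?num_real// lerXn2r ?nnegrE//.
apply: le_trans (ler_normB _ _) (le_trans _ (sum_norm_tau b z)).
by rewrite !big_ord_recl big_ord0 addr0 addrA lerDl.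
Qed.

Lemma diff_form_exV b : quad_eval (diff_form_bilin b) exV = sgb b / 3.
Proof.
rewrite quad_eval_exV /diff_form.
under eq_bigr => c _ do under eq_bigr => j _ do rewrite !tau_exA.
by rewrite big_bool /=; case: b; rewrite /= /sgb !big_ord_recl !big_ord0 /=; lra.
Qed.

Definition diff_functional b : dual_ball p :=
  exist _ (quad_eval (diff_form_bilin b) : {linear _ -> _}) (diff_form_dual b).

Lemma diff_form_ge0 b (w : Z) : 0 <= completion_emb p (tensor_pow 2 w) (diff_functional b).
Proof. by rewrite [leRHS]/(diff_form b w w) /diff_form -expr2 sqr_ge0. Qed.

Lemma exV_neq (w : Z) :
  completion_emb p exV <> completion_emb p (tensor_pow 2 w) /\
  completion_emb p exV <> - completion_emb p (tensor_pow 2 w).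
Proof.
split=> /(congr1 (fun g : fun_elt (completion_space p) => g (diff_functional _))) E.
  have := E false; rewrite [LHS]/= diff_form_exV => E1.
  by have := diff_form_ge0 false w; rewrite -E1 /sgb; lra.
have := E true; rewrite fun_eltN [LHS]/= diff_form_exV => E1.
by have := diff_form_ge0 true w; rewrite -oppr_le0 -E1 /sgb; lra.
Qed.

End example_point.

Theorem theorem2 (R : realType) :
  exists (Z : completeNormedModType R) (E : sym_proj_tensor_product 2 Z) (x : E),
    exposed_point (@closed_unit_ball R E) x /\
    forall w : Z,
      x <> sym_proj_emb E (tensor_pow 2 w) /\
      x <> - sym_proj_emb E (tensor_pow 2 w).
Proof.
exists (exZ R : completeNormedModType R), (sym_proj_completion 2 (exZ R)).
exists (completion_emb (@sym_proj_norm R 2 (exZ R)) (exV R)); split; last exact: exV_neq.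
have x1 : `|completion_emb (@sym_proj_norm R 2 (exZ R)) (exV R)| <= 1.
  by rewrite (completion_emb_norm (@sym_proj_normD R 2 _) (@sym_proj_normZ R 2 _)) exV_norm.
have xP : completion_emb (@sym_proj_norm R 2 (exZ R)) (exV R) (exP_functional R) = 1.
  exact: exP_exV.
apply: (exposed_point_dual x1 xP) => y y1 yP.
(* Both elements take the value [norming_value F] at every F. *)
by apply/val_inj/funext => F; rewrite /= (norming_unique y1 yP) -(norming_unique x1 xP).
Qed.
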